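(* Let $\{\mathcal{C}_m\}$ be a sequence of binary linear block codes whose codewords are transmitted with equal probability over a memoryless binary-input output-symmetric (MBIOS) channel of capacity $C$ (in bits per channel use), and assume that the block lengths of these codes tend to infinity as $m\to\infty$. For each $m$, let $\Gamma_{k,m}$ be the fraction of the parity-check nodes of degree $k$ for an arbitrary representation of $\mathcal{C}_m$ by a bipartite graph which corresponds to a full-rank parity-check matrix of $\mathcal{C}_m$, and assume that the limit $\Gamma_k = \lim_{m\to\infty}\Gamma_{k,m}$ exists for every $k$. Put $\Gamma(x)=\sum_k\Gamma_k x^k$. Let $R=\lim_{m\to\infty}R_m$ be the asymptotic rate, where $R_m$ is the rate of $\mathcal{C}_m$. If the bit error probability of $\mathcal{C}_m$ (under maximum-likelihood decoding, or any other decoding algorithm) vanishes as $m\to\infty$, then $$R \;\leq\; 1 - \frac{1-C}{1 - \frac{1}{2\ln 2} \sum_{p=1}^{\infty} \frac{\Gamma(g_p)}{p(2p-1)}},$$ where $$g_p = \int_0^{\infty} a(l)\,(1+e^{-l})\, \tanh^{2p}\!\left(\frac{l}{2}\right) dl, \qquad p \in \mathbb{N}=\{1,2,\dots\},$$ and $a$ is the conditional pdf of the log-likelihood ratio at the channel output given that the channel input is $+1$.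
   Context: An MBIOS channel is a memoryless channel with input alphabet $\{+1,-1\}$ and transition law $p_{Y|X}$ that is output-symmetric: $p_{Y|X}(y\mid 1)=p_{Y|X}(-y\mid -1)$ (real output $y$; in general, there is a measurable involution of the output alphabet playing the role of $y\mapsto -y$). Code bits $0,1$ are mapped to the inputs $+1,-1$ respectively. The log-likelihood ratio (LLR) of an output $y$ is $l=\ln\frac{p_{Y|X}(y\mid 1)}{p_{Y|X}(y\mid -1)}$. The ''pdf'' $a$ of the LLR given input $+1$ is understood in the generalized sense: the law of the LLR may contain point masses, including a point mass at $+\infty$ (e.g. for the binary erasure channel), and the integral defining $g_p$ then includes the contribution of that mass with the conventions $e^{-\infty}=0$, $\tanh(\infty)=1$. By channel symmetry, $a(-l)=e^{-l}a(l)$ for $l \ge 0$. The rate of a binary linear code of length $n$ is its dimension divided by $n$; a full-rank parity-check matrix is one whose rows are linearly independent over $GF(2)$ and span the dual code. In the bipartite graph of a parity-check matrix, parity-check nodes correspond to rows, variable nodes to columns, edges to the ones of the matrix; so a parity-check node has degree $k$ if its row has exactly $k$ ones. The capacity $C$ is the mutual information between a uniform input on $\{+1,-1\}$ and the channel output, in bits. Bit error probability: the codewords are the images of uniformly distributed vectors of $nR$ information bits under a linear bijective encoder, and the bit error probability is the average, over the $nR$ information bits, of the probability that the decoder's decision on that bit (a function of the whole received sequence) is wrong. *)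

(* Defs.v *)
From HB Require Import structures.
From mathcomp Require Import all_boot all_order all_algebra.
From mathcomp Require Import all_classical all_reals all_analysis.
From mathcomp Require Import measurable_realfun.
Set Implicit Arguments.
Unset Strict Implicit.
Unset Printing Implicit Defensive.
Import Order.TTheory GRing.Theory Num.Theory.
Import numFieldNormedType.Exports.

Local Open Scope classical_set_scope.
Local Open Scope ring_scope.

Inductive input := Plus | Minus.

Definition modulate (b : 'F_2) : input := if b == 0 then Plus else Minus.

(* The transition law is given by densities with respect to a reference measure
   invariant under the involution [flip] (Lebesgue measure with y |-> - y,
   counting measure, ...).  This loses no generality: for a symmetric pair of
   laws one may take [law Plus + law Minus] as reference. *)
Record mbios d (Y : measurableType d) (R : realType) := Mbios {
  ref : {sigma_finite_measure set Y -> \bar R} ;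
  flip : Y -> Y ;
  measurable_flip : measurable_fun setT flip ;
  flipK : involutive flip ;
  ref_flip : forall A, measurable A -> ref (flip @^-1` A) = ref A ;
  dens : input -> Y -> R ;
  dens_ge0 : forall x y, 0 <= dens x y ;
  measurable_dens : forall x, measurable_fun setT (dens x) ;
  dens_flip : forall y, dens Plus y = dens Minus (flip y) ;
  law : input -> probability Y R ;
  law_dens : forall x A, measurable A ->
    law x A = (\int[ref]_(y in A) (dens x y)%:E)%E }.

Section channel.
Context d (Y : measurableType d) (R : realType) (ch : mbios Y R).

(* [lne 0 = -oo] and, in the extended reals, [0^-1 = +oo], so that the LLR is
   +oo when only p(y|-1) vanishes and -oo when p(y|+1) vanishes; the outputs at
   which both densities vanish form a null set under either input. *)
Definition llr (y : Y) : \bar R :=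
  lne ((dens ch Plus y)%:E / (dens ch Minus y)%:E)%E.

Lemma measurable_llr : measurable_fun setT llr.
Proof.
have -> : llr = fun y => if dens ch Plus y == 0 then -oo%E else
    if dens ch Minus y == 0 then +oo%E else
    (ln (dens ch Plus y) - ln (dens ch Minus y))%:E.
  apply/funext => y; rewrite /llr.
  have [->|p0] := eqVneq (dens ch Plus y) 0; first by rewrite mul0e le0_lneNy.
  have pp : 0 < dens ch Plus y by rewrite lt0r p0 dens_ge0.
  have [->|m0] := eqVneq (dens ch Minus y) 0.
    by rewrite inve0 gt0_muley ?lte_fin.
  have mp : 0 < dens ch Minus y by rewrite lt0r m0 dens_ge0.
  by rewrite inver (negbTE m0) -EFinM lne_EFin ?divr_gt0// ln_div.
have m0 x : measurable_fun setT (fun y => dens ch x y == 0).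
  exact: (measurable_fun_eqr (measurable_dens ch x) (measurable_cst _)).
apply: measurable_fun_ifT => //; apply: measurable_fun_ifT => //.
apply/measurable_EFinP; apply: measurable_funB.
  by apply: measurableT_comp => //; exact: (measurable_dens ch Plus).
by apply: measurableT_comp => //; exact: (measurable_dens ch Minus).
Qed.

HB.instance Definition _ :=
  isMeasurableFun.Build _ _ _ _ llr measurable_llr.

(* The measure a(l) dl on the extended line. *)
Definition llr_law : probability (\bar R) R := distribution (law ch Plus) llr.

Definition tanh (x : R) : R := (expR x - expR (- x)) / (expR x + expR (- x)).

Definition tanhe (x : \bar R) : \bar R :=
  match x with r%:E => (tanh r)%:E | +oo => 1 | -oo => -1 end%E.

Definition g (p : nat) : R :=
  fine (\int[llr_law]_(l in [set l | 0 <= l])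
    ((1 + expeR (- l)) * tanhe (l * 2^-1%:E) ^+ (2 * p)))%E.

Definition log2 (x : R) : R := ln x / ln 2.

Definition out_dens (y : Y) : R := (dens ch Plus y + dens ch Minus y) / 2.

(* I(X;Y) for X uniform, with 0 log 0 = 0 since [ln 0 = 0]. *)
Definition capacity : R :=
  2^-1 * (\int[ref ch]_y
            (dens ch Plus y * log2 (dens ch Plus y / out_dens y)))
  + 2^-1 * (\int[ref ch]_y
            (dens ch Minus y * log2 (dens ch Minus y / out_dens y))).

End channel.

Section product_law.
Context d (Y : measurableType d) (R : realType).

Definition cons_tuple n (z : Y * n.-tuple Y) : n.+1.-tuple Y :=
  [the n.+1.-tuple Y of z.1 :: z.2].

Lemma measurable_cons_tuple n : measurable_fun setT (@cons_tuple n).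
Proof. exact: measurable_cons. Qed.

HB.instance Definition _ n := isMeasurableFun.Build _ _ _ _
  (@cons_tuple n) (@measurable_cons_tuple n).

Fixpoint product_law n : ('I_n -> probability Y R) -> probability (n.-tuple Y) R :=
  match n with
  | 0 => fun=> \d_([tuple] : 0.-tuple Y)
  | n'.+1 => fun P =>
      distribution (P ord0 \x @product_law n' (fun i => P (lift ord0 i)))%E
        (@cons_tuple n')
  end.

Definition block_law (ch : mbios Y R) n (x : 'rV['F_2]_n) :
    probability (n.-tuple Y) R :=
  product_law (fun j => law ch (modulate (x 0 j))).

End product_law.

Section code.
Variables (n : nat) (C : {vspace 'rV['F_2]_n}).

Definition rate (R : realType) : R := (\dim C)%:R / n%:R.

Definition in_dual (u : 'rV['F_2]_n) : Prop :=
  forall v, v \in C -> u *m v^T = 0.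

Definition full_rank_parity_check r (H : 'M['F_2]_(r, n)) : Prop :=
  row_free H /\ forall u : 'rV['F_2]_n, (u <= H)%MS <-> in_dual u.

Definition is_encoder (enc : 'Hom('rV['F_2]_(\dim C), 'rV['F_2]_n)) : Prop :=
  lker enc = 0%VS /\ limg enc = C.

Definition measurable_decoder d (Y : measurableType d)
    (dec : n.-tuple Y -> 'rV['F_2]_(\dim C)) : Prop :=
  forall i b, measurable [set y | dec y 0 i = b].

Definition bit_error_prob d (Y : measurableType d) (R : realType)
    (ch : mbios Y R) (enc : 'Hom('rV['F_2]_(\dim C), 'rV['F_2]_n))
    (dec : n.-tuple Y -> 'rV['F_2]_(\dim C)) : R :=
  (\dim C)%:R^-1 * \sum_(i < \dim C)
    (2 ^- \dim C * \sum_(u : 'rV['F_2]_(\dim C))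
      fine (block_law ch (enc u) [set y | dec y 0 i != u 0 i])).

End code.

Definition check_degree r n (H : 'M['F_2]_(r, n)) (i : 'I_r) : nat :=
  #|[set j | H i j == 1]%SET|.

Definition check_fraction (R : realType) r n (H : 'M['F_2]_(r, n)) (k : nat) : R :=
  #|[set i | check_degree H i == k]%SET|%:R / r%:R.

Definition gen_fun (R : realType) (Gamma : nat -> R) (x : R) : R :=
  limn [series Gamma k * x ^+ k]_k.

(* Main.v *)
Require Import Defs.
From HB Require Import structures.
From mathcomp Require Import all_boot all_order all_algebra.
From mathcomp Require Import all_classical all_reals all_analysis.
From mathcomp Require Import measurable_realfun.
From mathcomp Require Import ring lra.
Set Implicit Arguments.
Unset Strict Implicit.
Unset Printing Implicit Defensive.
Import Order.TTheory GRing.Theory Num.Theory.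
Import numFieldNormedType.Exports.
Local Open Scope classical_set_scope.
Local Open Scope ring_scope.

(** Write [t = tanh (l / 2)] for an output with log-likelihood ratio [l], and let
    [mu] be the average of the two output laws, so that the law of the output
    given the bit [b] has density [1 + (-1)^b t] with respect to [mu].  Then
    [g_p] is the [mu]-mean of [t^(2p)], and [(1 - C) ln 2] is the [mu]-mean of
    [h t], the entropy in nats of the probabilities [(1 + t) / 2, (1 - t) / 2].

    By channel symmetry, each coset of the code, decoded after flipping the
    outputs by a coset representative, is as good as the code; so the word sent
    may be taken uniform in F_2^n.  Its posterior [q] given the output word is
    then a product of Bernoulli laws, of entropy [\sum_j h (t_j)].  Compare [q], by a single use of
    Gibbs' inequality, with the law under which the syndrome bits are
    independent with their marginals under [q] and, given the syndrome, the
    decoder errs independently with probability [delta] on every information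
    bit.  The [i]-th syndrome bit has entropy [h (\prod_j t_j)], the product
    being over the support of the [i]-th row, and
    [h t <= ln 2 - 1/2 \sum_(1 <= p < N) t^(2p) / (p (2p - 1))].
    Averaging over the output, then letting the block length tend to infinity,
    [delta] to [0], and the truncation orders of the series in [k] and [p] to
    infinity gives
    [1 - C <= (1 - R) (1 - (2 ln 2)^-1 \sum_p Gamma (g_p) / (p (2p - 1)))]. *)

(** * Binary entropy *)

Section binary_entropy.
Context {R : realType}.
Implicit Types (t : R) (N : nat).

Definition hbin t : R :=
  - ((1 + t) / 2 * ln ((1 + t) / 2)) - (1 - t) / 2 * ln ((1 - t) / 2).

Lemma hbinN t : hbin (- t) = hbin t.
Proof. by rewrite /hbin opprK addrC. Qed.

Lemma hbin_ge0 t : `|t| <= 1 -> 0 <= hbin t.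
Proof.
rewrite ler_norml => /andP[t1 t2].
have xln (x : R) : 0 <= x <= 1 -> x * ln x <= 0.
  by move=> /andP[x0 x1]; rewrite mulr_ge0_le0// ln_le0.
have := xln ((1 + t) / 2); have := xln ((1 - t) / 2).
by rewrite /hbin => ha hb; have := ha ltac:(lra); have := hb ltac:(lra); lra.
Qed.

Lemma hbinE t : `|t| <= 1 ->
  hbin t = ln 2 - ((1 + t) * ln (1 + t) + (1 - t) * ln (1 - t)) / 2.
Proof.
rewrite ler_norml => /andP[t1 t2].
have e (x : R) : 0 <= x -> x / 2 * ln (x / 2) = (x * ln x - x * ln 2) / 2.
  rewrite le_eqVlt => /orP[/eqP <-|x0]; first by rewrite !mul0r subrr mul0r.
  by rewrite ln_div ?posrE//; field.
by rewrite /hbin !e; [field|lra|lra].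
Qed.

(** At [p = 0] the convention [0^-1 = 0] makes the coefficient vanish. *)
Definition hcoef (p : nat) : R := (p%:R * (2 * p%:R - 1))^-1.

Lemma hcoef_ge0 p : 0 <= hcoef p.
Proof.
rewrite invr_ge0; case: p => [|p]; first by rewrite mul0r.
by rewrite mulr_ge0// subr_ge0 -natrM ler1n.
Qed.

(** Truncated power series of [(1 + t) ln (1 + t) + (1 - t) ln (1 - t)], kept as a polynomial so
    that it can be differentiated formally. *)
Definition hpoly N : {poly R} := \sum_(1 <= p < N) hcoef p *: 'X^(2 * p).

Lemma hpolyE N t : (hpoly N).[t] = \sum_(1 <= p < N) hcoef p * t ^+ (2 * p).
Proof. by rewrite horner_sum; apply: eq_bigr => p _; rewrite !hornerE. Qed.

Lemma derivZXn (c : R) k : deriv (c *: 'X^k) = (c * k%:R) *: 'X^(k.-1).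
Proof. by rewrite derivZ derivXn -scaler_nat scalerA. Qed.

(** Differentiating [t^(2p)] twice gives the factor [2p (2p - 1)], which cancels [hcoef p] up to
    2. *)
Lemma hpoly_deriv2 N t :
  (hpoly N)^`()^`().[t] = \sum_(1 <= p < N) 2 * t ^+ (2 * p.-1).
Proof.
rewrite !(raddf_sum (@deriv R)) horner_sum big_nat [RHS]big_nat.
apply: eq_bigr => -[//|p] _.
rewrite /= !derivZXn hornerZ hornerXn /hcoef.
rewrite (_ : (2 * p.+1).-1.-1 = (2 * p)%N); last by rewrite mulnS.
rewrite (_ : (2 * p.+1).-1%:R = 2 * p.+1%:R - 1 :> R); last first.
  by rewrite -natrM mulnS add2n /= -[X in _ = X - 1]natr1 addrK.
congr (_ * _); rewrite natrM.
have p0 : p.+1%:R != 0 :> R by rewrite pnatr_eq0.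
have q0 : 2 * p.+1%:R - 1 != 0 :> R.
  by rewrite -natrM mulnS add2n -natr1 addrK pnatr_eq0.
by move: p.+1%:R p0 q0 => P p0 q0; field; rewrite p0 q0.
Qed.

(** The right-hand side is [2 / (1 - t^2)], the full geometric series of which the left-hand side is
    a partial sum. *)
Lemma hpoly_deriv2_le N t : 0 <= t < 1 ->
  (hpoly N)^`()^`().[t] <= (1 + t)^-1 + (1 - t)^-1.
Proof.
move=> /andP[t0 t1].
have -> : (1 + t)^-1 + (1 - t)^-1 = 2 / (1 - t ^+ 2).
  have : 1 + t != 0 by lra.
  have : 1 - t != 0 by lra.
  have : 1 - t ^+ 2 != 0 by have := mulr_gt0 (_ : 0 < 1 + t) (_ : 0 < 1 - t); nra.
  by move=> *; field; do ?[apply/andP; split].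
rewrite hpoly_deriv2 ler_pdivlMr; last by nra.
case: N => [|N]; first by rewrite big_geq// mul0r.
rewrite big_add1 /= -mulr_sumr big_mkord -mulrA ger_pMr//.
under eq_bigr do rewrite exprM.
by rewrite -opprB mulrN mulrC -subrX1 opprB gerBl exprn_ge0// sqr_ge0.
Qed.

Lemma ge0_derive (f f' : R -> R) :
  (forall x : R, 0 <= x < 1 -> is_derive x (1 : R) f (f' x)) -> f 0 = 0 ->
  (forall x : R, 0 <= x < 1 -> 0 <= f' x) -> forall x : R, 0 <= x < 1 -> 0 <= f x.
Proof.
move=> df f0 f'0 x /andP[x0 x1].
rewrite -f0; apply: (@ger0_derive1_ndecr _ f 0 x) => //.
- move=> y; rewrite in_itv/= => /andP[y0 y1].
  by have [] := df y; rewrite ?(ltW y0)/= ?(lt_trans y1).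
- move=> y; rewrite in_itv/= => /andP[y0 y1].
  have yi : 0 <= y < 1 by rewrite (ltW y0) (lt_trans y1).
  by have := df _ yi => d; rewrite derive1E derive_val f'0.
- apply: derivable_within_continuous => y; rewrite in_itv/= => /andP[y0 y1].
  by have [] := df y; rewrite ?y0/= ?(le_lt_trans y1).
Qed.

(** The inequality between second derivatives is integrated twice from 0. The endpoint 1 is excluded
    because [ln (1 - t)] is not differentiable there. *)
Lemma hbin_le_hpoly_lt1 N t : 0 <= t < 1 -> hbin t <= ln 2 - (hpoly N).[t] / 2.
Proof.
move=> t01.
(* [K] is the derivative of [G], both vanish at 0, and the claim is [G t >= 0]. *)
pose K (x : R) := ln (1 + x) - ln (1 - x) - (hpoly N)^`().[x].
pose G (x : R) := (1 + x) * ln (1 + x) + (1 - x) * ln (1 - x) - (hpoly N).[x].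
have dlnp (x : R) : 0 <= x < 1 -> is_derive x (1 : R) (fun y => ln (1 + y)) (1 + x)^-1.
  move=> x01; have xp : 0 < 1 + x by lra.
  have d1 : is_derive x (1 : R) (fun y : R => 1 + y) 1.
    by have := is_deriveD (is_derive_cst (1 : R) x 1) (is_derive_id x 1); rewrite add0r.
  have := @is_derive1_comp _ (@ln R) (fun y => 1 + y) x _ _ (is_derive1_ln xp) d1.
  by rewrite mulr1.
have dlnm (x : R) : 0 <= x < 1 ->
    is_derive x (1 : R) (fun y => ln (1 - y)) (- (1 - x)^-1).
  move=> x01; have xp : 0 < 1 - x by lra.
  have d1 : is_derive x (1 : R) (fun y : R => 1 - y) (- 1).
    by have := is_deriveB (is_derive_cst (1 : R) x 1) (is_derive_id x 1); rewrite add0r.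
  have := @is_derive1_comp _ (@ln R) (fun y => 1 - y) x _ _ (is_derive1_ln xp) d1.
  by rewrite mulrN1.
have hp0 : (hpoly N).[0] = 0.
  rewrite hpolyE big_nat big1// => -[//|p] _.
  by rewrite expr0n mulnS mulr0.
have dhp0 : (hpoly N)^`().[0] = 0.
  rewrite (raddf_sum (@deriv R)) horner_sum big_nat big1// => -[//|p] _.
  by rewrite /= derivZXn hornerZ hornerXn mulnS expr0n mulr0.
have K0 (x : R) : 0 <= x < 1 -> 0 <= K x.
  apply: (@ge0_derive _ (fun x : R => (1 + x)^-1 + (1 - x)^-1 - (hpoly N)^`()^`().[x])).
  - move=> y y01; have := dlnp y y01; have := dlnm y y01 => d1 d2.
    have := is_deriveB (is_deriveB d2 d1) (is_derive_poly (hpoly N)^`() y).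
    by rewrite opprK.
  - by rewrite /K dhp0 addr0 !subr0 subrr.
  - by move=> y y01; rewrite subr_ge0 hpoly_deriv2_le.
have G0 (x : R) : 0 <= x < 1 -> 0 <= G x.
  apply: (@ge0_derive _ K) => //.
  - move=> y y01; have := dlnp y y01; have := dlnm y y01 => d1 d2.
    have d3 : is_derive y (1 : R) (fun y : R => 1 + y) 1.
      by have := is_deriveD (is_derive_cst (1 : R) y 1) (is_derive_id y 1); rewrite add0r.
    have d4 : is_derive y (1 : R) (fun y : R => 1 - y) (- 1).
      by have := is_deriveB (is_derive_cst (1 : R) y 1) (is_derive_id y 1); rewrite add0r.
    have := is_deriveB (is_deriveD (is_deriveM d3 d2) (is_deriveM d4 d1))
      (is_derive_poly (hpoly N) y).
    move/is_derive_eq; apply; rewrite /K /GRing.scale/=.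
    have : 1 + y != 0 by lra.
    have : 1 - y != 0 by lra.
    by move=> ? ?; field; apply/andP.
  - by rewrite /G hp0 addr0 !subr0 ln1; lra.
by have := G0 t t01; rewrite /G hbinE ?ger0_norm; lra.
Qed.

(** Since [hbin >= 0], the bound holds at every [x < 1], hence in the limit from the left. It
    settles the endpoints of the next lemma and later bounds the series in [p]. *)
Lemma hpoly1_le N : (hpoly N).[1] <= 2 * ln 2.
Proof.
have cvgP : (hpoly N).[x] @[x --> 1^'-] --> (hpoly N).[1].
  apply: cvg_at_left_filter; exact: continuous_horner.
apply: (cvgr_to_le cvgP); near=> x.
have x01 : 0 <= x < 1 by apply/andP; split; near: x; [exact: nbhs_left_ge|exact: nbhs_left_lt].
have := hbin_le_hpoly_lt1 N x01; have := @hbin_ge0 x.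
by rewrite ger0_norm; lra.
Unshelve. all: by end_near. Qed.

Lemma hbin_le_hpoly N t : `|t| <= 1 -> hbin t <= ln 2 - (hpoly N).[t] / 2.
Proof.
wlog t0 : t / 0 <= t.
  move=> H t1; have [|/ltW tn] := leP 0 t; first by move=> /H; exact.
  have := H (- t); rewrite normrN hbinN oppr_ge0.
  suff -> : (hpoly N).[- t] = (hpoly N).[t] by exact.
  by rewrite !hpolyE; apply: eq_bigr => p _; rewrite !exprM sqrrN.
rewrite ger0_norm// le_eqVlt => /orP[/eqP ->|t1]; last exact/hbin_le_hpoly_lt1/andP.
have := hpoly1_le N.
have -> : hbin 1 = 0.
  have e : (1 + 1) / 2 = 1 :> R by lra.
  by rewrite /hbin e ln1; ring.
lra.
Qed.

End binary_entropy.

(** * Gibbs' inequality and sums over binary words *)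

Section gibbs.
Context {R : realType}.

(* Terms with [q i = 0] vanish, whatever the junk value of [ln 0]. *)
Lemma gibbs (T : finType) (q w : T -> R) :
  (forall i, 0 <= q i) -> (forall i, 0 <= w i) ->
  (forall i, 0 < q i -> 0 < w i) -> \sum_i w i <= \sum_i q i ->
  \sum_i q i * ln (w i) <= \sum_i q i * ln (q i).
Proof.
move=> q0 w0 qw wq; rewrite -subr_ge0 -sumrB.
(* Termwise, [q ln (q / w) >= q - w], which is [ln x <= x - 1] at [x = w / q]. *)
apply: (@le_trans _ _ (\sum_i (q i - w i))); first by rewrite sumrB subr_ge0.
apply: ler_sum => i _; have [qi|qi] := ltP 0 (q i); last first.
  have -> : q i = 0 by apply/eqP; rewrite eq_le qi q0.
  by rewrite !mul0r subr0 sub0r oppr_le0.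
have wi := qw _ qi.
rewrite -mulrBr -ln_div ?posrE//.
have h1 : ln (w i / q i) <= w i / q i - 1.
  have := @le_ln1Dx R (w i / q i - 1); rewrite [1 + _]addrC subrK.
  by apply; rewrite ltrBrDl subrr divr_gt0.
have e : ln (q i / w i) = - ln (w i / q i) by rewrite -lnV ?posrE ?divr_gt0// invf_div.
rewrite e mulrN lerNr opprB (le_trans (ler_wpM2l (q0 i) h1))//.
by rewrite mulrBr mulr1 mulrCA divff ?gt_eqF// mulr1.
Qed.

End gibbs.

Lemma ln_prod {R : realType} (I : Type) (s : seq I) (F : I -> R) :
  (forall i, 0 < F i) -> ln (\prod_(i <- s) F i) = \sum_(i <- s) ln (F i).
Proof.
move=> F0; elim: s => [|i s IH]; first by rewrite !big_nil ln1.
by rewrite !big_cons lnM ?IH// posrE ?F0// prodr_gt0.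
Qed.

Lemma sum_rV_prod (R : comPzRingType) (T : finType) n (F : 'I_n -> T -> R) :
  \sum_(z : 'rV[T]_n) \prod_j F j (z 0 j) = \prod_j \sum_b F j b.
Proof.
rewrite bigA_distr_bigA (reindex (fun z : 'rV[T]_n => [ffun j => z 0 j])) /=.
  by apply: eq_bigr => z _; apply: eq_bigr => j _; rewrite ffunE.
exists (fun f : {ffun 'I_n -> T} => \row_j f j) => z _.
  by apply/rowP => j; rewrite mxE ffunE.
by apply/ffunP => j; rewrite ffunE mxE.
Qed.

Lemma sumF2 (R : nmodType) (F : 'F_2 -> R) : \sum_b F b = F 0 + F 1.
Proof.
rewrite (big_ord_recl 1) big_ord1; congr (F _ + F _); exact: val_inj.
Qed.

Lemma F2_cases (b : 'F_2) : b = 0 \/ b = 1.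
Proof.
by case: b => -[|[|//]] i; [left|right]; apply: val_inj.
Qed.

(** * Product Bernoulli laws and parity characters *)

Section product_bernoulli.
Context {R : realType} {n : nat} (t : 'I_n -> R).
Hypothesis t1 : forall j, `|t j| <= 1.
Implicit Types (J : {set 'I_n}) (z : 'rV['F_2]_n).

Definition sgn (b : 'F_2) : R := if b == 0 then 1 else -1.

(** By Bayes' rule, the posterior of a uniform word when [t j] is the posterior mean of the sign of
    bit [j]. *)
Definition qprod z : R := \prod_j ((1 + sgn (z 0 j) * t j) / 2).

(** The character of F_2^n attached to [J]: the sign of the parity of [z] on [J]. Its mean under
    [qprod] is [tau J]. *)
Definition chi J z : R := \prod_(j in J) sgn (z 0 j).

Definition tau J : R := \prod_(j in J) t j.

Lemma sgn_sqr b : sgn b * sgn b = 1.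
Proof. by rewrite /sgn; case: ifP; rewrite ?mulrNN mulr1. Qed.

Lemma chi_pm1 J z : chi J z = 1 \/ chi J z = -1.
Proof.
rewrite /chi; elim/big_ind: _; [by left| |].
  by move=> x y [->|->] [->|->]; rewrite ?mulrNN ?mulN1r ?mulr1 ?mul1r; [left|right|right|left].
by move=> j _; rewrite /sgn; case: ifP; [left|right].
Qed.

Lemma tau_le1 J : `|tau J| <= 1.
Proof.
rewrite /tau normr_prod; apply: prodr_ile1 => j _.
by rewrite normr_ge0 t1.
Qed.

Lemma half_ge0 (e x : R) : e = 1 \/ e = -1 -> `|x| <= 1 -> 0 <= (1 + e * x) / 2.
Proof. by case=> ->; rewrite ler_norml => /andP[? ?]; lra. Qed.

Lemma qprod_ge0 z : 0 <= qprod z.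
Proof.
apply: prodr_ge0 => j _; apply: half_ge0 => //.
by rewrite /sgn; case: ifP; [left|right].
Qed.

(** The sum factors over the coordinates: a coordinate in [J] contributes [t j], any other
    contributes 1. *)
Lemma sum_qprod_chi J : \sum_z qprod z * chi J z = tau J.
Proof.
under eq_bigr do rewrite /chi big_mkcond -big_split /=.
rewrite (sum_rV_prod (fun j b => (1 + sgn b * t j) / 2 * (if j \in J then sgn b else 1))).
rewrite /tau [RHS]big_mkcond; apply: eq_bigr => j _; rewrite sumF2 /sgn eqxx oner_eq0.
by case: ifP => _; field.
Qed.

Lemma sum_qprod : \sum_z qprod z = 1.
Proof.
have := sum_qprod_chi finset.set0; rewrite /tau big_set0 => <-.
by apply: eq_bigr => z _; rewrite /chi big_set0 mulr1.
Qed.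

(** The right-hand side is the [qprod]-probability of the words with the same parity as [z] on [J],
    and [z] is one of them. *)
Lemma qprod_le_half J z : qprod z <= (1 + chi J z * tau J) / 2.
Proof.
have -> : (1 + chi J z * tau J) / 2 = \sum_z' qprod z' * ((1 + chi J z * chi J z') / 2).
  transitivity ((\sum_z' qprod z' + chi J z * \sum_z' qprod z' * chi J z') / 2).
    by rewrite sum_qprod sum_qprod_chi.
  rewrite mulr_sumr -big_split mulr_suml.
  by apply: eq_bigr => z' _ /=; field.
rewrite (bigD1 z)//=.
have chi2 : chi J z * chi J z = 1 by case: (chi_pm1 J z) => ->; rewrite ?mulrNN mulr1.
rewrite chi2 divff ?mulr1 ?pnatr_eq0// lerDl; apply: sumr_ge0 => z' _.
rewrite mulr_ge0 ?qprod_ge0//; apply: half_ge0; first exact: chi_pm1.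
by case: (chi_pm1 J z') => ->; rewrite ?normrN normr1.
Qed.

Lemma sum_qprod_ln J :
  \sum_z qprod z * ln ((1 + chi J z * tau J) / 2) = - hbin (tau J).
Proof.
set a := (1 + tau J) / 2; set b := (1 - tau J) / 2.
(* As [chi] only takes the values 1 and -1, the logarithm is the affine function [A + B * chi],
   whose mean is known. *)
pose A := (ln a + ln b) / 2; pose B := (ln a - ln b) / 2.
transitivity (\sum_z (A * qprod z + B * (qprod z * chi J z))).
  apply: eq_bigr => z _.
  case: (chi_pm1 J z) => ->; rewrite ?mulN1r ?mul1r ?mulr1 -/a -/b /A /B; by field.
rewrite big_split/= -!mulr_sumr sum_qprod sum_qprod_chi /hbin -/a -/b /A /B.
by rewrite /a /b; field.
Qed.

(** Each factor of [qprod] is the marginal for a singleton [J], so the previous lemma applies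
    coordinate by coordinate. *)
Lemma sum_qprod_lnq : \sum_z qprod z * ln (qprod z) = - \sum_j hbin (t j).
Proof.
transitivity (\sum_z \sum_j qprod z * ln ((1 + chi [set j]%SET z * tau [set j]%SET) / 2)).
  apply: eq_bigr => z _; rewrite -mulr_sumr.
  have [->|qz] := eqVneq (qprod z) 0; first by rewrite !mul0r.
  congr (_ * _); rewrite /qprod ln_prod/=.
    by apply: eq_bigr => j _; rewrite /chi /tau !big_set1.
  move=> j; have := qprod_le_half [set j]%SET z; rewrite /chi /tau !big_set1.
  by apply: lt_le_trans; rewrite lt0r qz qprod_ge0.
rewrite exchange_big/= -sumrN; apply: eq_bigr => j _.
by rewrite sum_qprod_ln /tau big_set1.
Qed.

End product_bernoulli.

(** * Entropy bound for the posterior, via syndrome and decoder *)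

Definition check_support r n (H : 'M['F_2]_(r, n)) (i : 'I_r) : {set 'I_n} :=
  [set j | H i j == 1]%SET.

Section equivocation.
Context {R : realType} {n r k : nat} (t : 'I_n -> R).
Hypothesis t1 : forall j, `|t j| <= 1.
Variables (H : 'M['F_2]_(r, n)) (c : 'rV['F_2]_r * 'rV['F_2]_k -> 'rV['F_2]_n).
(* [c (s, u)] is the word that carries the information word [u] in the coset of
   syndrome [s]. *)
Hypothesis bij_c : bijective c.
Hypothesis cH : forall su, c su *m H^T = su.1.

Lemma sgnD (a b : 'F_2) : sgn (a + b) = sgn a * sgn b :> R.
Proof.
have s0 : sgn 0 = 1 :> R by rewrite /sgn eqxx.
case: (F2_cases a) => ->; first by rewrite add0r s0 mul1r.
case: (F2_cases b) => ->; first by rewrite addr0 s0 mulr1.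
have -> : 1 + 1 = 0 :> 'F_2 by exact: val_inj.
by rewrite s0 sgn_sqr.
Qed.

(** A syndrome bit is the parity of the word on the support of its row; hence its marginal under
    [qprod] is governed by [tau]. *)
Lemma chi_check i z : chi (check_support H i) z = sgn ((z *m H^T) 0 i) :> R.
Proof.
rewrite mxE (big_morph (@sgn R) sgnD (erefl _)) /chi big_mkcond.
apply: eq_bigr => j _; rewrite inE mxE.
case: (F2_cases (H i j)) => ->; first by rewrite mulr0.
by rewrite mulr1.
Qed.

Lemma equivocation_bound (dl : 'rV['F_2]_r -> 'rV['F_2]_k) (delta : R) :
  0 < delta < 1 ->
  \sum_j hbin (t j) <= \sum_i hbin (tau t (check_support H i))
    + k%:R * - ln (1 - delta)
    + - ln delta * \sum_(l < k) \sum_su qprod t (c su) * (dl su.1 0 l != su.2 0 l)%:R.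
Proof.
move=> /andP[d0 d1].
have d1' : 0 < 1 - delta by rewrite subr_gt0.
pose beta (s : 'rV['F_2]_r) (u : 'rV['F_2]_k) (l : 'I_k) : R :=
  if dl s 0 l == u 0 l then 1 - delta else delta.
have beta_gt0 s u l : 0 < beta s u l by rewrite /beta; case: ifP.
pose wi (su : 'rV['F_2]_r * 'rV['F_2]_k) i : R :=
  (1 + sgn (su.1 0 i) * tau t (check_support H i)) / 2.
pose w (su : 'rV['F_2]_r * 'rV['F_2]_k) := (\prod_i wi su i) * \prod_l beta su.1 su.2 l.
pose q su := qprod t (c su).
have q0 su : 0 <= q su by exact: qprod_ge0.
have reind (F : 'rV['F_2]_n -> R) : \sum_z F z = \sum_su F (c su).
  by rewrite (reindex c)//; exact: onW_bij.
have wiE su i : wi su i = (1 + chi (check_support H i) (c su) * tau t (check_support H i)) / 2.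
  by rewrite chi_check cH.
(* This domination makes [w] positive wherever [q] is, as Gibbs' inequality requires. *)
have q_wi su i : q su <= wi su i by rewrite wiE; exact: qprod_le_half.
have wi0 su i : 0 <= wi su i by rewrite (le_trans _ (q_wi _ _)).
have w0 su : 0 <= w su.
  by rewrite mulr_ge0// prodr_ge0// => l _; exact: ltW.
have qw su : 0 < q su -> 0 < w su.
  move=> qp; rewrite mulr_gt0// prodr_gt0// => i _.
  exact: lt_le_trans (q_wi _ _).
have sumw : \sum_su w su = 1.
  (* Summing over [u] first, every factor [beta] adds up to 1; then so does every syndrome
     marginal. *)
  rewrite -(pair_bigA _ (fun s u => w (s, u))) /=.
  transitivity (\sum_(s : 'rV['F_2]_r) \prod_i ((1 + sgn (s 0 i) * tau t (check_support H i)) / 2)).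
    apply: eq_bigr => s _; rewrite /w /wi /= -mulr_sumr /beta.
    rewrite (sum_rV_prod (fun l b => if dl s 0 l == b then 1 - delta else delta)).
    rewrite [X in _ * X]big1 ?mulr1// => l _; rewrite sumF2.
    by case: (F2_cases (dl s 0 l)) => ->; rewrite ?eqxx /=; ring.
  rewrite (sum_rV_prod (fun i b => (1 + sgn b * tau t (check_support H i)) / 2)).
  by rewrite big1// => i _; rewrite sumF2 /sgn eqxx oner_eq0; field.
have sumq : \sum_su q su = 1 by rewrite -(reind (qprod t)) sum_qprod.
have G : \sum_su q su * ln (w su) <= \sum_su q su * ln (q su).
  by apply: gibbs => //; rewrite sumw sumq.
rewrite -(reind (fun z => qprod t z * ln (qprod t z))) sum_qprod_lnq// in G.
have E su : q su * ln (w su) =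
    \sum_i q su * ln (wi su i) + \sum_l q su * ln (beta su.1 su.2 l).
  rewrite -!mulr_sumr -mulrDr.
  have [->|qn] := eqVneq (q su) 0; first by rewrite !mul0r.
  have qp : 0 < q su by rewrite lt0r qn q0.
  have wip i : 0 < wi su i by exact: lt_le_trans (q_wi _ _).
  by rewrite lnM ?posrE ?prodr_gt0// !ln_prod.
move: G; under eq_bigr do rewrite E.
rewrite big_split/= exchange_big/= [X in _ + X <= _ -> _]exchange_big/=.
have -> : \sum_i \sum_su q su * ln (wi su i) = - \sum_i hbin (tau t (check_support H i)).
  rewrite -sumrN; apply: eq_bigr => i _; rewrite -sum_qprod_ln// reind.
  by apply: eq_bigr => su _; rewrite wiE.
rewrite -lerN2 opprK opprD opprK => /le_trans; apply.
rewrite -addrA lerD2l mulNr mulrN -opprD lerN2 mulr_sumr.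
rewrite -[k in k%:R](card_ord k) -sum1_card natr_sum mulr_suml -big_split/=.
apply: ler_sum => l _; rewrite mul1r.
rewrite [X in X + _ <= _](_ : _ = \sum_su q su * ln (1 - delta)); last first.
  by rewrite -mulr_suml sumq mul1r.
rewrite mulr_sumr -big_split/=; apply: ler_sum => su _.
rewrite mulrCA -mulrDr ler_wpM2l// /beta.
case: ifP => _ /=; first by rewrite mulr0 addr0.
(* A wrong bit is charged for [ln (1 - delta)] as well, which is nonpositive. *)
by rewrite mulr1 gerDr ln_le0// gerBl ltW.
Qed.

End equivocation.

(** * Integration over product laws *)

Section product_law_integral.
Context d (Y : measurableType d) (R : realType).
Local Open Scope ereal_scope.

(* [Defs.cons_tuple] is qualified since [tuple.cons_tuple] shadows it. *)
Lemma integral_product_law0 (P : 'I_0 -> probability Y R)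
    (F : 0.-tuple Y -> \bar R) : measurable_fun setT F ->
  \int[product_law P]_y F y = F [tuple].
Proof. by move=> mF; rewrite /= integral_dirac// diracT mul1e. Qed.

Lemma integral_product_lawS n (P : 'I_n.+1 -> probability Y R)
    (F : n.+1.-tuple Y -> \bar R) :
  measurable_fun setT F -> (forall y, 0 <= F y) ->
  \int[product_law P]_y F y =
  \int[P ord0]_y \int[product_law (fun i => P (lift ord0 i))]_ys
     F (Defs.cons_tuple (y, ys)).
Proof.
move=> mF F0 /=; rewrite ge0_integral_distribution//.
rewrite fubini_tonelli1//=.
by apply: measurableT_comp => //; exact: measurable_cons_tuple.
Qed.

Lemma measurable_cons_tuple_pair n (y : Y) :
  measurable_fun setT (fun ys : n.-tuple Y => Defs.cons_tuple (y, ys)).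
Proof.
exact: (measurableT_comp (@measurable_cons_tuple _ _ n) (measurable_pair1 y)).
Qed.

Lemma measurable_integral_product_law n (P : 'I_n -> probability Y R)
    (F : n.+1.-tuple Y -> \bar R) :
  measurable_fun setT F -> (forall y, 0 <= F y) ->
  measurable_fun setT (fun y => \int[product_law P]_ys F (Defs.cons_tuple (y, ys))).
Proof.
move=> mF F0.
apply: (@measurable_fun_fubini_tonelli_F _ _ _ _ _ (product_law P) (F \o @Defs.cons_tuple _ _ n)).
- by apply: measurableT_comp => //; exact: measurable_cons_tuple.
- by move=> x /=.
Qed.

Lemma tnth_cons_tuple0 n (y : Y) (ys : n.-tuple Y) :
  tnth (Defs.cons_tuple (y, ys)) ord0 = y.
Proof. by []. Qed.

Lemma tnth_cons_tupleS n (y : Y) (ys : n.-tuple Y) i :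
  tnth (Defs.cons_tuple (y, ys)) (lift ord0 i) = tnth ys i.
Proof. exact: tnthS. Qed.

Lemma measurable_prod_tnth n (rho : 'I_n -> Y -> R) :
  (forall i, measurable_fun setT (rho i)) ->
  measurable_fun setT (fun y : n.-tuple Y => (\prod_i rho i (tnth y i))%R).
Proof.
move=> mrho; apply: measurable_prod => i _.
by apply: measurableT_comp => //; exact: measurable_tnth.
Qed.

Lemma emeasurable_prod_tnth n (F : n.-tuple Y -> \bar R) (rho : 'I_n -> Y -> R) :
  measurable_fun setT F -> (forall i, measurable_fun setT (rho i)) ->
  measurable_fun setT (fun y => F y * (\prod_i rho i (tnth y i))%:E).
Proof.
move=> mF mrho; apply: emeasurable_funM => //; apply/measurable_EFinP.
exact: (measurable_prod_tnth mrho).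
Qed.

(** Tonelli's theorem, one coordinate at a time. The density hypothesis is stated on integrals, the
    form in which the induction uses it. *)
Lemma integral_product_law_dens n (P : 'I_n -> probability Y R)
    (mu : probability Y R) (rho : 'I_n -> Y -> R) :
  (forall i, measurable_fun setT (rho i)) -> (forall i y, (0 <= rho i y)%R) ->
  (forall i (f : Y -> \bar R), measurable_fun setT f -> (forall y, 0 <= f y) ->
     \int[P i]_y f y = \int[mu]_y (f y * (rho i y)%:E)) ->
  forall F : n.-tuple Y -> \bar R,
  measurable_fun setT F -> (forall y, 0 <= F y) ->
  \int[product_law P]_y F y =
  \int[product_law (fun _ : 'I_n => mu)]_y (F y * (\prod_i rho i (tnth y i))%:E).
Proof.
elim: n P rho => [|n IH] P rho mrho rho0 dP F mF F0.
  rewrite !integral_product_law0//; first by rewrite big_ord0 mule1.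
  exact: (emeasurable_prod_tnth mF mrho).
rewrite integral_product_lawS// dP//; last 2 first.
- exact: measurable_integral_product_law.
- by move=> y; exact: integral_ge0.
rewrite integral_product_lawS//; last 2 first.
- exact: (emeasurable_prod_tnth mF mrho).
- by move=> y; rewrite mule_ge0// lee_fin prodr_ge0.
apply: eq_integral => y _.
have mFy : measurable_fun setT (fun ys : n.-tuple Y => F (Defs.cons_tuple (y, ys))).
  by apply: measurableT_comp => //; exact: measurable_cons_tuple_pair.
rewrite (IH _ (fun i => rho (lift ord0 i)) _ _ (fun i => dP (lift ord0 i)))//.
rewrite -ge0_integralZr//; last 3 first.
- exact: (emeasurable_prod_tnth mFy (fun i => mrho (lift ord0 i))).
- by move=> ys _; rewrite mule_ge0// lee_fin prodr_ge0.
- by rewrite lee_fin.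
apply: eq_integral => ys _; rewrite big_ord_recl -muleA -EFinM mulrC.
by congr (_ * (_ * _)%:E); apply: eq_bigr => i _; rewrite tnth_cons_tupleS.
Qed.

Definition map_tnth n (phi : 'I_n -> Y -> Y) (y : n.-tuple Y) : n.-tuple Y :=
  [tuple phi i (tnth y i) | i < n].

Lemma measurable_map_tnth n (phi : 'I_n -> Y -> Y) :
  (forall i, measurable_fun setT (phi i)) -> measurable_fun setT (map_tnth phi).
Proof.
move=> mphi; apply/measurable_fun_tnthP => i.
rewrite (_ : _ \o _ = phi i \o (fun y : n.-tuple Y => tnth y i)).
  by apply: measurableT_comp => //; exact: measurable_tnth.
by apply/funext => y /=; rewrite tnth_mktuple.
Qed.

Lemma map_tnth_cons n (phi : 'I_n.+1 -> Y -> Y) y (ys : n.-tuple Y) :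
  map_tnth phi (Defs.cons_tuple (y, ys)) =
  Defs.cons_tuple (phi ord0 y, map_tnth (fun i => phi (lift ord0 i)) ys).
Proof.
apply: eq_from_tnth => i; rewrite tnth_mktuple.
case: (unliftP ord0 i) => [j ->|->//].
by rewrite !tnth_cons_tupleS tnth_mktuple.
Qed.

Lemma integral_product_law_map n (P P' : 'I_n -> probability Y R)
    (phi : 'I_n -> Y -> Y) :
  (forall i, measurable_fun setT (phi i)) ->
  (forall i (f : Y -> \bar R), measurable_fun setT f -> (forall y, 0 <= f y) ->
     \int[P' i]_y f y = \int[P i]_y f (phi i y)) ->
  forall F : n.-tuple Y -> \bar R,
  measurable_fun setT F -> (forall y, 0 <= F y) ->
  \int[product_law P']_y F y = \int[product_law P]_y F (map_tnth phi y).
Proof.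
elim: n P P' phi => [|n IH] P P' phi mphi dP F mF F0.
  rewrite !integral_product_law0//; first by rewrite [in RHS]tuple0.
  exact: (measurableT_comp mF (measurable_map_tnth mphi)).
rewrite integral_product_lawS// dP//; last 2 first.
- exact: measurable_integral_product_law.
- by move=> y; exact: integral_ge0.
rewrite (integral_product_lawS _ (measurableT_comp mF (measurable_map_tnth mphi))).
apply: eq_integral => y _.
rewrite (IH (fun i => P (lift ord0 i)) _ (fun i => phi (lift ord0 i)) _
  (fun i => dP (lift ord0 i)))//.
- by apply: eq_integral => ys _ /=; rewrite map_tnth_cons.
- by apply: measurableT_comp => //; exact: measurable_cons_tuple_pair.
- by move=> y; exact: F0.
Qed.

(** Independence: the mean of a product of functions of distinct coordinates is the product of the
    means. *)
Lemma integral_product_law_prod n (mu : probability Y R) (psi : 'I_n -> Y -> R)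
    (a : 'I_n -> R) :
  (forall i, measurable_fun setT (psi i)) -> (forall i y, (0 <= psi i y)%R) ->
  (forall i, \int[mu]_y (psi i y)%:E = (a i)%:E) ->
  \int[product_law (fun _ : 'I_n => mu)]_y (\prod_i psi i (tnth y i))%:E =
  (\prod_i a i)%:E.
Proof.
elim: n psi a => [|n IH] psi a mpsi psi0 ia.
  rewrite integral_product_law0 ?big_ord0//.
  apply/measurable_EFinP; exact: (measurable_prod_tnth mpsi).
rewrite integral_product_lawS//; last 2 first.
- apply/measurable_EFinP; exact: (measurable_prod_tnth mpsi).
- by move=> y; rewrite lee_fin prodr_ge0.
under eq_integral => y _.
  under eq_integral => ys _.
    rewrite big_ord_recl tnth_cons_tuple0 EFinM.
    under eq_bigr do rewrite tnth_cons_tupleS.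
    over.
  rewrite ge0_integralZl//; last 3 first.
  - apply/measurable_EFinP; exact: (measurable_prod_tnth (fun i => mpsi (lift ord0 i))).
  - by move=> ys _; rewrite lee_fin prodr_ge0.
  - by rewrite lee_fin.
  rewrite (IH (fun i => psi (lift ord0 i)) (fun i => a (lift ord0 i)))//.
  over.
rewrite ge0_integralZr//; last 3 first.
- exact/measurable_EFinP.
- by move=> ys _; rewrite lee_fin.
- rewrite lee_fin prodr_ge0// => i _; rewrite -lee_fin -ia integral_ge0// => y _.
  by rewrite lee_fin.
by rewrite ia -EFinM big_ord_recl.
Qed.

End product_law_integral.

(** * Integration against densities and mixtures *)

Section density.
Context d (T : measurableType d) (R : realType).
Local Open Scope ereal_scope.
Import HBNNSimple.

(** The identity is linear in [F] and known for indicators, so it holds for simple functions;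
    monotone convergence extends it. *)
Lemma ge0_integral_density (mu nu : {measure set T -> \bar R}) (rho : T -> R) :
  measurable_fun setT rho -> (forall x, (0 <= rho x)%R) ->
  (forall A, measurable A -> nu A = \int[mu]_(x in A) (rho x)%:E) ->
  forall F : T -> \bar R, measurable_fun setT F -> (forall x, 0 <= F x) ->
  \int[nu]_x F x = \int[mu]_x (F x * (rho x)%:E).
Proof.
move=> mrho rho0 nuE F mF F0.
pose h := nnsfun_approx measurableT mF.
have mh n : measurable_fun setT (EFin \o h n).
  exact/measurable_EFinP/measurable_funP.
have h_cvg x : (h n x)%:E @[n --> \oo] --> F x by exact: cvg_nnsfun_approx.
have h_nd x : {homo (fun n => (h n x)%:E) : a b / (a <= b)%N >-> a <= b}.
  by move=> a b ab; rewrite lee_fin; exact/lefP/nd_nnsfun_approx.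
have hE n : \int[nu]_x (h n x)%:E = \int[mu]_x ((h n x)%:E * (rho x)%:E).
  rewrite integral_nnsfun// patch_setT sintegralE.
  under [RHS]eq_integral => x _.
    rewrite fimfunE -fsumEFin// ge0_mule_fsuml; last first.
      by move=> r; exact: nnfun_muleindic_ge0.
    over.
  rewrite ge0_integral_fsum//=; last 2 first.
  - by move=> r; apply/measurable_EFinP; do 2 apply: measurable_funM => //.
  - by move=> r x _; rewrite mule_ge0 ?lee_fin//; rewrite -lee_fin EFinM nnfun_muleindic_ge0.
  apply: eq_fsbigr => r rh.
  have r0 : (0 <= r)%R by move: rh; rewrite inE => -[x _ <-].
  under eq_integral do rewrite EFinM -muleA.
  rewrite ge0_integralZl//; last 2 first.
  - by apply/measurable_EFinP; apply: measurable_funM.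
  - by move=> x _; rewrite mule_ge0// lee_fin.
  congr (_ * _); rewrite nuE// integral_mkcond; apply: eq_integral => x _.
  by rewrite patchE indicE; case: ifPn => _; rewrite ?mul1e ?mul0e.
have {1}-> : F = (fun x => limn (fun n => (h n x)%:E)).
  by apply/funext => x; apply/esym/cvg_lim.
rewrite monotone_convergence//; last by move=> n x _; rewrite lee_fin.
have -> : (fun x => F x * (rho x)%:E) = (fun x => limn (fun n => (h n x)%:E * (rho x)%:E)).
  by apply/funext => x; apply/esym/cvg_lim => //; exact: cvgeZr.
rewrite monotone_convergence//.
- by congr (limn _); apply/funext => n; exact: hE.
- by move=> n; apply: emeasurable_funM => //; exact/measurable_EFinP.
- by move=> n x _; rewrite mule_ge0// lee_fin.
- by move=> x _ a b ab; rewrite lee_wpmul2r ?lee_fin//; apply/lefP/nd_nnsfun_approx.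
Qed.

End density.

Section mixture.
Context d (T : measurableType d) (R : realType) (P Q : probability T R).
Local Open Scope ereal_scope.

Definition mixture : set T -> \bar R :=
  mscale (((2^-1 : R)%:nng)%R) (measure_add P Q).

HB.instance Definition _ := Measure.copy mixture
  (mscale (((2^-1 : R)%:nng)%R) (measure_add P Q)).

Lemma mixture_setT : mixture setT = 1.
Proof.
transitivity ((2^-1)%:E * measure_add P Q setT); first by [].
rewrite measure_addE; transitivity ((2^-1)%:E * (1 + 1) : \bar R).
  by congr (_ * (_ + _)); exact: probability_setT.
by rewrite -EFinD -EFinM mulVf.
Qed.

HB.instance Definition _ := Measure_isProbability.Build _ _ _ mixture mixture_setT.

Lemma integral_mixture (F : T -> \bar R) :
  measurable_fun setT F -> (forall x, 0 <= F x) ->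
  \int[mixture]_x F x = (2^-1)%:E * (\int[P]_x F x + \int[Q]_x F x).
Proof.
by move=> mF F0; rewrite /mixture ge0_integral_mscale// ge0_integral_measure_add.
Qed.

End mixture.

(** * The channel *)

Lemma measurable_hbin (R : realType) : measurable_fun setT (@hbin R).
Proof.
have m1 : measurable_fun setT (fun t : R => (1 + t) / 2).
  by apply: measurable_funM => //; exact: measurable_funD.
have m2 : measurable_fun setT (fun t : R => (1 - t) / 2).
  by apply: measurable_funM => //; exact: measurable_funB.
apply: measurable_funB.
- apply: measurable_funN.
  by apply: measurable_funM => //; exact: measurableT_comp.
- by apply: measurable_funM => //; exact: measurableT_comp.
Qed.

Section channel.
Context d (Y : measurableType d) (R : realType) (ch : mbios Y R).

(* [tanh (l / 2)], where [l] is the log-likelihood ratio. *)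
Definition soft (y : Y) : R :=
  (dens ch Plus y - dens ch Minus y) / (dens ch Plus y + dens ch Minus y).

Definition avg_law : probability Y R := mixture (law ch Plus) (law ch Minus).

Lemma out_dens_ge0 y : 0 <= out_dens ch y.
Proof. by rewrite divr_ge0// addr_ge0// dens_ge0. Qed.

Lemma measurable_out_dens : measurable_fun setT (out_dens ch).
Proof.
by apply: measurable_funM => //; apply: measurable_funD; exact: measurable_dens.
Qed.

Lemma soft_le1 y : `|soft y| <= 1.
Proof.
have p0 := dens_ge0 ch Plus y; have m0 := dens_ge0 ch Minus y.
have s0 := addr_ge0 p0 m0.
rewrite /soft normrM normfV (ger0_norm s0).
have [->|sn] := eqVneq (dens ch Plus y + dens ch Minus y) 0.
  by rewrite invr0 mulr0.
by rewrite ler_pdivrMr ?lt0r ?sn// mul1r ler_norml; lra.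
Qed.

Lemma measurable_soft : measurable_fun setT soft.
Proof.
(* On nonnegative reals, 0 included, inversion is the power of exponent -1, a measurable
   function. *)
rewrite (_ : soft = fun y => (dens ch Plus y - dens ch Minus y) *
    (dens ch Plus y + dens ch Minus y) `^ (-1)); last first.
  by apply/funext => y; rewrite powR_inv1// addr_ge0// dens_ge0.
apply: measurable_funM.
  by apply: measurable_funB; exact: measurable_dens.
apply: (measurableT_comp (f := fun x : R => x `^ (-1))) => //.
by apply: measurable_funD; exact: measurable_dens.
Qed.

Lemma dens_soft b y :
  dens ch (modulate b) y = out_dens ch y * (1 + sgn b * soft y).
Proof.
have p0 := dens_ge0 ch Plus y; have m0 := dens_ge0 ch Minus y.
rewrite /out_dens /soft /modulate /sgn.
(* If the sum vanishes, so do both densities, by nonnegativity. *)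
have [s0|sn] := eqVneq (dens ch Plus y + dens ch Minus y) 0.
  by rewrite s0 !mul0r; case: ifP => _; lra.
by case: ifP => _; field.
Qed.

Lemma dens_flip_bit b y : dens ch (modulate b) (flip ch y) = dens ch (modulate (b + 1)) y.
Proof.
case: (F2_cases b) => ->; first by rewrite dens_flip flipK.
have -> : 1 + 1 = 0 :> 'F_2 by exact: val_inj.
by rewrite /modulate eqxx oner_eq0 -dens_flip.
Qed.

Lemma soft_flip y : soft (flip ch y) = - soft y.
Proof.
have := dens_flip_bit 0 y; have := dens_flip_bit 1 y.
have -> : 1 + 1 = 0 :> 'F_2 by exact: val_inj.
rewrite add0r /modulate eqxx oner_eq0 /soft => -> ->.
by rewrite -mulNr opprB [X in _ / X = _]addrC.
Qed.

Local Open Scope ereal_scope.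
Variable (F : Y -> \bar R).
Hypotheses (mF : measurable_fun setT F) (F0 : forall y, 0 <= F y).

Lemma integral_law x : \int[law ch x]_y F y = \int[ref ch]_y (F y * (dens ch x y)%:E).
Proof.
apply: ge0_integral_density => //; first exact: measurable_dens.
- exact: dens_ge0.
- exact: law_dens.
Qed.

Lemma integral_avg_law :
  \int[avg_law]_y F y = \int[ref ch]_y (F y * (out_dens ch y)%:E).
Proof.
have mx x : measurable_fun setT (fun y => F y * (dens ch x y)%:E).
  by apply: emeasurable_funM => //; apply/measurable_EFinP; exact: measurable_dens.
have x0 x y : 0 <= F y * (dens ch x y)%:E.
  by rewrite mule_ge0// lee_fin dens_ge0.
rewrite integral_mixture// !integral_law -ge0_integralD// -ge0_integralZl//.
- apply: eq_integral => y _; rewrite -ge0_muleDr ?lee_fin ?dens_ge0//.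
  by rewrite muleCA -EFinD -EFinM /out_dens mulrC.
- exact: emeasurable_funD.
- by move=> y _; rewrite adde_ge0.
Qed.

End channel.

Section channel_integral.
Context d (Y : measurableType d) (R : realType) (ch : mbios Y R).
Local Open Scope ereal_scope.
Variable (F : Y -> \bar R).
Hypotheses (mF : measurable_fun setT F) (F0 : forall y, 0 <= F y).

Lemma integral_law_soft b :
  \int[law ch (modulate b)]_y F y =
  \int[avg_law ch]_y (F y * (1 + sgn b * soft ch y)%:E).
Proof.
have s0 y : (0 <= 1 + sgn b * soft ch y)%R.
  have := soft_le1 ch y; rewrite ler_norml => /andP[? ?].
  by rewrite /sgn; case: ifP => _; lra.
rewrite integral_law// integral_avg_law.
- by apply: eq_integral => y _; rewrite dens_soft -muleA -EFinM mulrC.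
- apply: emeasurable_funM => //; apply/measurable_EFinP.
  apply: measurable_funD => //; apply: measurable_funM => //.
  exact: measurable_soft.
- by move=> y; rewrite mule_ge0// lee_fin.
Qed.

Lemma integral_ref_flip : \int[ref ch]_y F (flip ch y) = \int[ref ch]_y F y.
Proof.
rewrite -(@ge0_integral_pushforward _ _ _ _ _ _ (measurable_flip ch) _ setT F)//.
apply: eq_measure_integral; first exact: measurable_flip.
by move=> mf A mA _; exact: ref_flip.
Qed.

End channel_integral.

(** * Symmetry of the channel *)

Section channel_symmetry.
Context d (Y : measurableType d) (R : realType) (ch : mbios Y R).
Local Open Scope ereal_scope.

Definition flip_bit (c : 'F_2) (y : Y) : Y := if c == 0%R then y else flip ch y.

Lemma measurable_flip_bit c : measurable_fun setT (flip_bit c).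
Proof.
by rewrite /flip_bit; case: (c == 0)%R => //; exact: measurable_flip.
Qed.

(** Flipping the output undoes the addition of [c] to the input bit. This is what later transports
    the decoder to the cosets. *)
Lemma integral_law_flip (F : Y -> \bar R) (b c : 'F_2) :
  measurable_fun setT F -> (forall y, 0 <= F y) ->
  \int[law ch (modulate (b + c)%R)]_y F (flip_bit c y) =
  \int[law ch (modulate b)]_y F y.
Proof.
move=> mF F0; case: (F2_cases c) => ->; first by rewrite addr0 /flip_bit eqxx.
rewrite /flip_bit oner_eq0.
have mf : measurable_fun setT (flip ch) by exact: measurable_flip.
rewrite !integral_law//; last exact: (measurableT_comp mF).
rewrite -[RHS]integral_ref_flip.
- by apply: eq_integral => y _; rewrite dens_flip_bit.
- by apply: emeasurable_funM => //; apply/measurable_EFinP; exact: measurable_dens.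
- by move=> y; rewrite mule_ge0// lee_fin dens_ge0.
Qed.

Lemma out_dens_flip y : out_dens ch (flip ch y) = out_dens ch y.
Proof.
have := dens_flip_bit ch 0%R y; have := dens_flip_bit ch 1%R y.
have -> : (1 + 1 = 0 :> 'F_2)%R by exact: val_inj.
by rewrite add0r /modulate eqxx oner_eq0 /out_dens => -> ->; rewrite addrC.
Qed.

Lemma integral_avg_flip (F : Y -> \bar R) :
  measurable_fun setT F -> (forall y, 0 <= F y) ->
  \int[avg_law ch]_y F (flip ch y) = \int[avg_law ch]_y F y.
Proof.
move=> mF F0.
have mf : measurable_fun setT (flip ch) by exact: measurable_flip.
rewrite !integral_avg_law//; last exact: (measurableT_comp mF).
rewrite -[RHS]integral_ref_flip.
- by apply: eq_integral => y _; rewrite out_dens_flip.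
- apply: emeasurable_funM => //; apply/measurable_EFinP; exact: measurable_out_dens.
- by move=> y; rewrite mule_ge0// lee_fin out_dens_ge0.
Qed.

End channel_symmetry.

(** * Moments of the log-likelihood ratio, and capacity *)

Section llr_integral.
Context d (Y : measurableType d) (R : realType) (ch : mbios Y R).
Implicit Types (l : \bar R) (p : nat).

Lemma measurable_funV_ge0 d' (T : measurableType d') (f : T -> R) :
  measurable_fun setT f -> (forall x, 0 <= f x) ->
  measurable_fun setT (fun x => (f x)^-1).
Proof.
move=> mf f0; rewrite (_ : (fun _ => _) = (fun x => f x `^ (-1))).
  exact: (measurableT_comp (f := fun x : R => x `^ (-1))).
by apply/funext => x; rewrite powR_inv1.
Qed.

Lemma measurable_tanh : measurable_fun setT (@tanh R).
Proof.
have me : measurable_fun setT (fun x : R => expR (- x)) by exact: measurableT_comp.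
apply: measurable_funM; first exact: measurable_funB.
apply: measurable_funV_ge0; first exact: measurable_funD.
by move=> x; rewrite addr_ge0// expR_ge0.
Qed.

Lemma tanh_half (x : R) : tanh (x * 2^-1) = (expR x - 1) / (expR x + 1).
Proof.
rewrite /tanh.
have -> : expR x = expR (x * 2^-1) * expR (x * 2^-1).
  by rewrite -expRD; congr expR; lra.
rewrite expRN; set a := expR (x * 2^-1).
have a0 : 0 < a by exact: expR_gt0.
have a1 : a != 0 by rewrite gt_eqF.
have a2 : a * a + 1 != 0 by rewrite gt_eqF// addr_gt0// mulr_gt0.
by field; rewrite a2 a1.
Qed.

Definition g_integrand p l : \bar R := ((1 + expeR (- l)) * tanhe (l * 2^-1%:E) ^+ (2 * p))%E.

Lemma g_integrand_EFin p (x : R) :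
  g_integrand p x%:E = ((1 + expR (- x)) * tanh (x * 2^-1) ^+ (2 * p))%:E.
Proof. by rewrite /g_integrand -EFinM /= -EFin_expe -EFinM. Qed.

Lemma g_integrand_pinfty p : g_integrand p +oo%E = 1%E.
Proof.
rewrite /g_integrand gt0_mulye ?lte_fin ?invr_gt0//= adde0 mul1e.
by rewrite -EFin_expe expr1n.
Qed.

Lemma g_integrand_ge0 p l : (0 <= l -> 0 <= g_integrand p l)%E.
Proof.
case: l => [x _| _|//]; last by rewrite g_integrand_pinfty.
rewrite g_integrand_EFin lee_fin mulr_ge0 ?addr_ge0 ?expR_ge0//.
by rewrite exprM exprn_ge0// sqr_ge0.
Qed.

Lemma measurable_g_integrand p :
  measurable_fun setT (g_integrand p \_ [set l : \bar R | (0 <= l)%E]).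
Proof.
rewrite (_ : _ \_ _ = fun l => if (0 <= l)%E then (if l == +oo%E then 1%E else
    ((1 + expR (- fine l)) * tanh (fine l * 2^-1) ^+ (2 * p))%:E) else 0%E).
  have mf : measurable_fun setT (@fine R) by exact: fine_measurable.
  apply: measurable_fun_ifT => //.
    exact: measurable_fun_lee.
  apply: measurable_fun_ifT => //.
    exact: measurable_fun_eqe.
  apply/measurable_EFinP; apply: measurable_funM.
    apply: measurable_funD => //; apply: measurableT_comp => //.
    exact: measurableT_comp.
  apply: measurable_funX; apply: (measurableT_comp measurable_tanh).
  exact: measurable_funM.
apply/funext => l; rewrite patchE.
case: ifPn => [|]; last by rewrite notin_setE/= => /negP/negbTE ->.
rewrite inE/= => l0; rewrite l0; case: l l0 => [x _|_|//]; first by rewrite g_integrand_EFin.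
by rewrite eqxx g_integrand_pinfty.
Qed.

(** Where [l >= 0], [tanh (l / 2)] is [soft] and [(1 + e^(-l)) (1 + soft) = 2]; at [l = +oo] the
    factors are 1 and 2. At [soft = 0] the power vanishes, because [p > 0]. *)
Lemma g_integrand_llr p y : (0 < p)%N ->
  ((g_integrand p \_ [set l : \bar R | (0 <= l)%E]) (llr ch y) * (1 + soft ch y)%:E =
   (if 0 < soft ch y then 2 * soft ch y ^+ (2 * p) else 0)%:E)%E.
Proof.
move=> p0; rewrite patchE /llr.
have a0 := dens_ge0 ch Plus y; have b0 := dens_ge0 ch Minus y.
rewrite /soft; move: (dens ch Plus y) (dens ch Minus y) a0 b0 => a b a0 b0.
have [->|an] := eqVneq a 0.
  rewrite mul0e le0_lneNy// memNset//= mul0e ifF//.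
  apply/negbTE; rewrite -leNgt sub0r add0r mulNr oppr_le0.
  by rewrite divr_ge0.
have ap : 0 < a by rewrite lt0r an a0.
have [->|bn] := eqVneq b 0.
  rewrite inve0 gt0_muley ?lte_fin//= mem_set//= g_integrand_pinfty mul1e.
  rewrite subr0 addr0 divff// ltr01 expr1n; congr EFin; lra.
have bp : 0 < b by rewrite lt0r bn b0.
have abp := divr_gt0 ap bp.
rewrite inver (negbTE bn) -EFinM lne_EFin//.
have sp : 0 < a + b by exact: addr_gt0.
have sn : a + b != 0 by rewrite gt_eqF.
have tE : tanh (ln (a / b) * 2^-1) = (a - b) / (a + b).
  by rewrite tanh_half lnK ?posrE//; field; rewrite sn bn.
have [ab|ba] := leP b a.
  rewrite mem_set/=; last by rewrite lee_fin ln_ge0// ler_pdivlMr// mul1r.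
  rewrite g_integrand_EFin tE expRN lnK ?posrE// -EFinM; congr EFin.
  move: ab; rewrite le_eqVlt => /orP[/eqP->|ab].
    by rewrite subrr mul0r ltxx expr0n -(prednK p0) mulnS mulr0 mul0r.
  rewrite divr_gt0 ?subr_gt0//; move: (_ ^+ _) => z.
  by field; rewrite sn bn an.
rewrite memNset/= ?mul0e.
  rewrite ifF//; apply/negbTE; rewrite -leNgt.
  by rewrite pmulr_lle0 ?invr_gt0// subr_le0 ltW.
apply/negP; rewrite -ltNge lte_fin ln_lt0// abp/=.
by rewrite ltr_pdivrMr// mul1r.
Qed.

Local Open Scope ereal_scope.

Lemma integral_soft_pow p : (0 < p)%N ->
  \int[avg_law ch]_y ((soft ch y ^+ (2 * p))%R)%:E = (g ch p)%:E.
Proof.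
move=> p0.
pose G y : \bar R := (if (0 < soft ch y)%R then (soft ch y ^+ (2 * p))%R else 0%R)%:E.
have t2 y : (0 <= soft ch y ^+ (2 * p))%R by rewrite exprM exprn_ge0// sqr_ge0.
have mt : measurable_fun setT (fun y => (soft ch y ^+ (2 * p))%R).
  by apply: measurable_funX; exact: measurable_soft.
have G0 y : 0 <= G y by rewrite lee_fin; case: ifP.
have mG : measurable_fun setT G.
  apply/measurable_EFinP; apply: measurable_fun_ifT => //.
  by apply: measurable_fun_ltr => //; exact: measurable_soft.
have E1 : \int[llr_law ch]_(l in [set l | 0 <= l]) g_integrand p l = 2%:E * \int[avg_law ch]_y G y.
  rewrite integral_mkcond ge0_integral_distribution//; last 2 first.
  - exact: measurable_g_integrand.
  - by move=> l; rewrite patchE; case: ifPn => //; rewrite inE => /g_integrand_ge0.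
  have := @integral_law_soft _ _ _ ch
    ((g_integrand p \_ [set l : \bar R | 0 <= l]) \o llr ch) _ _ 0%R.
  rewrite {1}/modulate eqxx => ->.
  - rewrite -ge0_integralZl//; apply: eq_integral => y _ /=.
    by rewrite /sgn eqxx mul1r g_integrand_llr// /G; case: ifP; rewrite -EFinM ?mulr0.
  - by apply: measurableT_comp; [exact: measurable_g_integrand|exact: measurable_llr].
  - by move=> y /=; rewrite patchE; case: ifPn => //; rewrite inE => /g_integrand_ge0.
(* The flip preserves [avg_law] and negates [soft], so the outputs with [soft < 0] contribute as
   much as those with [soft > 0]. *)
have E2 : \int[avg_law ch]_y ((soft ch y ^+ (2 * p))%R)%:E = 2%:E * \int[avg_law ch]_y G y.
  have -> : 2%:E * \int[avg_law ch]_y G y =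
      \int[avg_law ch]_y G y + \int[avg_law ch]_y G (flip ch y).
    by rewrite integral_avg_flip// mule_natl mule2n.
  rewrite -ge0_integralD//; last first.
    by apply: (measurableT_comp mG); exact: measurable_flip.
  apply: eq_integral => y _; rewrite /G soft_flip oppr_gt0 -EFinD; congr EFin.
  have -> : ((- soft ch y) ^+ (2 * p) = soft ch y ^+ (2 * p))%R by rewrite !exprM sqrrN.
  have [||->] := ltgtP (soft ch y) 0%R; rewrite ?addr0 ?add0r//.
  by rewrite expr0n -(prednK p0) mulnS.
(* [g] is defined through [fine], so finiteness is needed; the integrand is at most 1. *)
have : \int[avg_law ch]_y ((soft ch y ^+ (2 * p))%R)%:E \is a fin_num.
  rewrite ge0_fin_numE; last by apply: integral_ge0 => y _; rewrite lee_fin.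
  apply: (@le_lt_trans _ _ (\int[avg_law ch]_y cst 1 y)); last first.
    by rewrite integral_cst// mul1e [X in X < _]probability_setT ltry.
  apply: ge0_le_integral => //.
  - by move=> y _; rewrite lee_fin.
  - exact/measurable_EFinP.
  - move=> y _; rewrite lee_fin /= exprM -real_normK ?num_real// -exprM.
    by rewrite exprn_ile1// soft_le1.
by move=> fin; rewrite -[LHS](fineK fin) E2 -E1.
Qed.

Lemma measurable_hbin_soft : measurable_fun setT (fun y => hbin (soft ch y)).
Proof. exact: (measurableT_comp (@measurable_hbin R) (measurable_soft ch)). Qed.

Lemma hbin_le_ln2 (t : R) : (`|t| <= 1 -> hbin t <= ln 2)%R.
Proof.
by move=> /(hbin_le_hpoly 0); rewrite hpolyE big_geq// mul0r subr0.
Qed.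

(** From [ln x <= x - 1] at [x] and at [x^-1] follows [x - 1 <= x ln x <= x (x - 1)] for [x > 0].
    The bound dominates the integrands of the capacity. *)
Lemma xlnx_norm_le2 (x : R) : (0 <= x <= 2 -> `|x * ln x| <= 2)%R.
Proof.
move=> /andP[x0 x2]; have [->|xn] := eqVneq x 0%R; first by rewrite mul0r normr0.
have xp : (0 < x)%R by rewrite lt0r xn x0.
have h1 := @le_ln1Dx R (x - 1)%R; have h2 := @le_ln1Dx R (x^-1 - 1)%R.
rewrite [(1 + _)%R]addrC subrK in h1; rewrite [(1 + _)%R]addrC subrK lnV ?posrE// in h2.
have {}h1 := h1 ltac:(lra).
have {}h2 : (- ln x <= x^-1 - 1)%R by apply: h2; rewrite ltrBrDl subrr invr_gt0.
have {}h2 : (x * - ln x <= x * (x^-1 - 1))%R by rewrite ler_pM2l.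
have {}h1 : (x * ln x <= x * (x - 1))%R by rewrite ler_pM2l.
rewrite mulrBr divff// mulr1 mulrN in h2.
by rewrite ler_norml; apply/andP; split; nra.
Qed.

Lemma out_dens_integral : \int[ref ch]_y (out_dens ch y)%:E = 1.
Proof.
have := @integral_avg_law _ _ _ ch (cst 1) (measurable_cst _) (fun=> lee01).
rewrite integral_cst// mul1e [X in X = _ -> _]probability_setT => ->.
by apply: eq_integral => y _; rewrite mul1e.
Qed.

(** Dividing by [out_dens] leaves [1 + sgn b * soft]; where [out_dens] is 0 both sides vanish. *)
Lemma capacity_term b y :
  (dens ch (modulate b) y * log2 (dens ch (modulate b) y / out_dens ch y) =
   out_dens ch y * ((1 + sgn b * soft ch y) * ln (1 + sgn b * soft ch y)) / ln 2)%R.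
Proof.
rewrite dens_soft /log2; have [->|on] := eqVneq (out_dens ch y) 0%R.
  by rewrite !mul0r.
by rewrite [(out_dens ch y * _ / _)%R]mulrAC divff// mul1r !mulrA.
Qed.

Lemma soft_sgn_itv b y : (0 <= 1 + sgn b * soft ch y <= 2)%R.
Proof.
have := soft_le1 ch y; rewrite ler_norml => /andP[? ?].
by rewrite /sgn; case: ifP => _; lra.
Qed.

Lemma ln2_gt0 : (0 < ln 2 :> R)%R.
Proof. by rewrite ln_gt0// ltr1n. Qed.

Lemma integrable_capacity_term x : (ref ch).-integrable setT
  (EFin \o (fun y => dens ch x y * log2 (dens ch x y / out_dens ch y))%R).
Proof.
have -> : x = modulate (if x is Plus then 0%R else 1%R).
  by case: x; rewrite /modulate ?eqxx ?oner_eq0.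
set b : 'F_2 := if _ is Plus then _ else _.
rewrite (_ : (fun y => _) = (fun y =>
   out_dens ch y * ((1 + sgn b * soft ch y) * ln (1 + sgn b * soft ch y)) / ln 2)%R); last first.
  by apply/funext => y; exact: capacity_term.
apply: (@le_integrable _ _ _ _ _ _ _ (EFin \o (fun y => (2 / ln 2) * out_dens ch y)%R)) => //.
- apply/measurable_EFinP; apply: measurable_funM => //; apply: measurable_funM.
    exact: measurable_out_dens.
  have m1 : measurable_fun setT (fun y => 1 + sgn b * soft ch y)%R.
    apply: measurable_funD => //; apply: measurable_funM => //.
    exact: measurable_soft.
  by apply: measurable_funM => //; exact: measurableT_comp.
- move=> y _ /=; rewrite lee_fin.
  have := xlnx_norm_le2 (soft_sgn_itv b y); have := out_dens_ge0 ch y.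
  move: (out_dens ch y) (_ * ln _)%R => o u o0 u2; have l0 := ln2_gt0.
  rewrite [X in (_ <= X)%R]ger0_norm; last by rewrite mulr_ge0// divr_ge0// ltW.
  rewrite normrM (gtr0_norm (x := (ln 2)^-1)%R) ?invr_gt0// mulrAC ler_pM2r ?invr_gt0//.
  by rewrite normrM (ger0_norm o0) mulrC ler_wpM2r.
- apply/integrableP; split.
    apply/measurable_EFinP; apply: measurable_funM => //.
    exact: measurable_out_dens.
  under eq_integral => y _.
    rewrite /= ger0_norm; last by rewrite mulr_ge0 ?out_dens_ge0// divr_ge0// ltW// ln2_gt0.
    rewrite EFinM; over.
  rewrite ge0_integralZl//.
  - by rewrite out_dens_integral mule1 ltry.
  - apply/measurable_EFinP; exact: measurable_out_dens.
  - by move=> y _; rewrite lee_fin out_dens_ge0.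
  - by rewrite lee_fin divr_ge0// ltW// ln2_gt0.
Qed.

Lemma integral_hbin_soft :
  \int[avg_law ch]_y (hbin (soft ch y))%:E = (ln 2 * (1 - capacity ch))%:E.
Proof.
have l0 := ln2_gt0; have ln0 : (ln 2 != 0 :> R)%R by rewrite gt_eqF.
(* [K] is the integrand, in nats, of the mutual information against [avg_law]. Its mean is [ln 2]
   times the capacity, and the mean of [hbin] is the complement to [ln 2]. *)
pose K y := (ln 2 - hbin (soft ch y))%R.
have K0 y : (0 <= K y)%R by rewrite subr_ge0 hbin_le_ln2// soft_le1.
have mK : measurable_fun setT K.
  by apply: measurable_funB => //; exact: measurable_hbin_soft.
have h0 y : (0 <= hbin (soft ch y))%R by rewrite hbin_ge0// soft_le1.
have mh := measurable_hbin_soft.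
have S : \int[avg_law ch]_y (K y)%:E + \int[avg_law ch]_y (hbin (soft ch y))%:E = (ln 2)%:E.
  rewrite -ge0_integralD//; last 4 first.
  - by move=> y _; rewrite lee_fin.
  - exact/measurable_EFinP.
  - by move=> y _; rewrite lee_fin.
  - exact/measurable_EFinP.
  under eq_integral do rewrite -EFinD /K subrK.
  by rewrite integral_cst// [X in _ * X]probability_setT mule1.
have C : \int[avg_law ch]_y (K y)%:E = (ln 2 * capacity ch)%:E.
  rewrite /capacity -mulrDr -RintegralD//; last 2 first.
  - exact: integrable_capacity_term.
  - exact: integrable_capacity_term.
  have e y : (dens ch Plus y * log2 (dens ch Plus y / out_dens ch y) +
      dens ch Minus y * log2 (dens ch Minus y / out_dens ch y) =
      2 / ln 2 * (K y * out_dens ch y))%R.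
    have := capacity_term (0 : 'F_2)%R y; have := capacity_term (1 : 'F_2)%R y.
    rewrite /modulate /sgn eqxx oner_eq0 mulN1r mul1r => -> ->.
    by rewrite /K hbinE ?soft_le1//; field.
  rewrite /Rintegral; under eq_integral do rewrite e EFinM.
  rewrite ge0_integralZl//; last 3 first.
  - apply/measurable_EFinP; apply: measurable_funM => //.
    exact: measurable_out_dens.
  - by move=> y _; rewrite lee_fin mulr_ge0// out_dens_ge0.
  - by rewrite lee_fin divr_ge0// ltW.
  under eq_integral do rewrite EFinM.
  rewrite -(@integral_avg_law _ _ _ ch (EFin \o K)); last 2 first.
  - exact/measurable_EFinP.
  - by move=> y; rewrite lee_fin.
  have : \int[avg_law ch]_y (K y)%:E \is a fin_num.
    rewrite ge0_fin_numE; last by apply: integral_ge0 => y _; rewrite lee_fin.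
    apply: (@le_lt_trans _ _ (ln 2)%:E); last exact: ltry.
    by rewrite -S leeDl// integral_ge0// => y _; rewrite lee_fin.
  case: (\int[_]_y _) => //= c _; congr EFin; field.
  by rewrite ln0.
move: S; rewrite C; case: (\int[_]_y _) => //= c [S]; congr EFin.
by rewrite mulrBr mulr1; lra.
Qed.

End llr_integral.

(** * Blocks *)

Section mean.
Context d (T : measurableType d) (R : realType) (P : probability T R).
Implicit Types (f : T -> R) (a c : R).

(** Nonnegativity and a real value are bundled, so that sums and comparisons need no separate
    integrability argument. *)
Definition has_mean f a : Prop :=
  [/\ measurable_fun setT f, forall x, 0 <= f x & (\int[P]_x (f x)%:E = a%:E)%E].

Lemma has_mean_cst c : 0 <= c -> has_mean (fun=> c) c.
Proof.
by move=> c0; split => //; rewrite integral_cst// [X in (_ * X)%E]probability_setT mule1.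
Qed.

Lemma has_meanD f a f' a' :
  has_mean f a -> has_mean f' a' -> has_mean (fun x => f x + f' x) (a + a').
Proof.
move=> [mf f0 fa] [mf' f'0 fa']; split; first exact: measurable_funD.
  by move=> x; rewrite addr_ge0.
under eq_integral do rewrite EFinD.
rewrite ge0_integralD ?fa ?fa'//.
- by move=> x _; rewrite lee_fin.
- exact/measurable_EFinP.
- by move=> x _; rewrite lee_fin.
- exact/measurable_EFinP.
Qed.

Lemma has_meanZ c f a : 0 <= c -> has_mean f a -> has_mean (fun x => c * f x) (c * a).
Proof.
move=> c0 [mf f0 fa]; split; first exact: measurable_funM.
  by move=> x; rewrite mulr_ge0.
under eq_integral do rewrite EFinM.
rewrite ge0_integralZl ?fa//.
- exact/measurable_EFinP.
- by move=> x _; rewrite lee_fin.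
Qed.

Lemma has_mean_sum (I : eqType) (s : seq I) (f : I -> T -> R) (a : I -> R) :
  (forall i, i \in s -> has_mean (f i) (a i)) ->
  has_mean (fun x => \sum_(i <- s) f i x) (\sum_(i <- s) a i).
Proof.
elim: s => [|i s IH] fa.
  rewrite big_nil (_ : (fun _ => _) = (fun=> 0)); last first.
    by apply/funext => x; rewrite big_nil.
  exact: has_mean_cst.
rewrite big_cons (_ : (fun _ => _) = (fun x => f i x + \sum_(j <- s) f j x)); last first.
  by apply/funext => x; rewrite big_cons.
apply: has_meanD; first by apply: fa; rewrite mem_head.
by apply: IH => j js; apply: fa; rewrite in_cons js orbT.
Qed.

Lemma le_mean f a f' a' :
  has_mean f a -> has_mean f' a' -> (forall x, f x <= f' x) -> a <= a'.
Proof.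
move=> [mf f0 fa] [mf' f'0 fa'] ff'; rewrite -lee_fin -fa -fa'.
apply: ge0_le_integral => //.
- by move=> x _; rewrite lee_fin.
- exact/measurable_EFinP.
- exact/measurable_EFinP.
- by move=> x _; rewrite lee_fin.
Qed.

End mean.

Section block.
Context d (Y : measurableType d) (R : realType) (ch : mbios Y R) (n : nat).

Definition avg_block_law : probability (n.-tuple Y) R :=
  product_law (fun _ : 'I_n => avg_law ch).

Definition softs (y : n.-tuple Y) (j : 'I_n) : R := soft ch (tnth y j).

Lemma softs_le1 y j : `|softs y j| <= 1.
Proof. exact: soft_le1. Qed.

Lemma has_mean_prod (psi : 'I_n -> Y -> R) (a : 'I_n -> R) :
  (forall j, has_mean (avg_law ch) (psi j) (a j)) ->
  has_mean avg_block_law (fun y => \prod_j psi j (tnth y j)) (\prod_j a j).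
Proof.
move=> h; split.
- by apply: measurable_prod_tnth => j; have [] := h j.
- by move=> y; apply: prodr_ge0 => j _; have [] := h j.
- by apply: integral_product_law_prod => j; have [] := h j.
Qed.

Lemma has_mean_prod_in (J : {set 'I_n}) (psi : Y -> R) (a : R) :
  has_mean (avg_law ch) psi a ->
  has_mean avg_block_law (fun y => \prod_(j in J) psi (tnth y j)) (a ^+ #|J|).
Proof.
move=> h.
(* Coordinates outside [J] receive the constant factor 1. *)
have := @has_mean_prod (fun j y => if j \in J then psi y else 1)
  (fun j => if j \in J then a else 1).
rewrite -big_mkcond prodr_const.
rewrite (_ : (fun y : n.-tuple Y => \prod_j _) = (fun y => \prod_(j in J) psi (tnth y j))).
  by apply=> j; case: ifP => // _; exact: has_mean_cst.
by apply/funext => y; rewrite [RHS]big_mkcond.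
Qed.

Lemma has_mean_hbin j :
  has_mean avg_block_law (fun y => hbin (softs y j)) (ln 2 * (1 - capacity ch)).
Proof.
have := @has_mean_prod_in [set j]%SET (fun y => hbin (soft ch y)) (ln 2 * (1 - capacity ch)).
rewrite cards1 expr1 (_ : (fun _ => _) = (fun y => hbin (softs y j))).
  apply; split; [exact: measurable_hbin_soft| |exact: integral_hbin_soft].
  by move=> y; rewrite hbin_ge0// soft_le1.
by apply/funext => y; rewrite big_set1.
Qed.

(** The outputs are independent under the averaged law, so a check of degree [k] yields [g_p^k]; the
    generating function of the degrees arises here. *)
Lemma has_mean_tau (J : {set 'I_n}) p : (0 < p)%N ->
  has_mean avg_block_law (fun y => tau (softs y) J ^+ (2 * p)) (g ch p ^+ #|J|).
Proof.
move=> p0.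
have := @has_mean_prod_in J (fun y => soft ch y ^+ (2 * p)) (g ch p).
rewrite (_ : (fun y : n.-tuple Y => \prod_(j in J) _) =
    (fun y => tau (softs y) J ^+ (2 * p))).
  apply; split; [|by move=> y; rewrite exprM exprn_ge0// sqr_ge0|exact: integral_soft_pow].
  by apply: measurable_funX; exact: measurable_soft.
by apply/funext => y; rewrite /tau prodrXl.
Qed.

(** Bayes' rule for a uniform word: [2 ^ n] times the posterior of [x] is the density of its output
    law with respect to the averaged law. *)
Lemma has_mean_qprod (x : 'rV['F_2]_n) (A : set (n.-tuple Y)) : measurable A ->
  has_mean avg_block_law (fun y => qprod (softs y) x * \1_A y)
    (2 ^- n * fine (block_law ch x A)).
Proof.
move=> mA.
pose rho (j : 'I_n) (y : Y) : R := 1 + sgn (x 0 j) * soft ch y.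
have mrho j : measurable_fun setT (rho j).
  apply: measurable_funD => //; apply: measurable_funM => //.
  exact: measurable_soft.
have rho0 j y : 0 <= rho j y by have /andP[] := soft_sgn_itv ch (x 0 j) y.
have qE y : qprod (softs y) x = 2 ^- n * \prod_j rho j (tnth y j).
  rewrite /qprod big_split/= mulrC; congr (_ * _).
  by rewrite prodr_const card_ord exprVn.
have m1 : measurable_fun setT (fun y => (\1_A y : R)) by exact: measurable_indic.
rewrite (_ : (fun _ => _) = (fun y => 2 ^- n * (\1_A y * \prod_j rho j (tnth y j)))); last first.
  by apply/funext => y; rewrite qE -mulrA [_ * \1_A y]mulrC.
apply: has_meanZ; first by rewrite invr_ge0 exprn_ge0.
split.
- by apply: measurable_funM => //; exact: (measurable_prod_tnth mrho).
- by move=> y; rewrite mulr_ge0// prodr_ge0.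
under eq_integral do rewrite EFinM.
rewrite -(@integral_product_law_dens _ _ _ n (fun j => law ch (modulate (x 0 j)))
  (avg_law ch) rho mrho rho0 _ (fun y => (\1_A y)%:E)).
- by rewrite integral_indic// setIT fineK// fin_num_measure.
- by move=> j f mf f0; exact: integral_law_soft.
- exact/measurable_EFinP.
- by move=> y; rewrite lee_fin.
Qed.

Definition flip_word (c : 'rV['F_2]_n) : n.-tuple Y -> n.-tuple Y :=
  map_tnth (fun j => flip_bit ch (c 0 j)).

Lemma measurable_flip_word c : measurable_fun setT (flip_word c).
Proof. by apply: measurable_map_tnth => j; exact: measurable_flip_bit. Qed.

Lemma block_law_flip (x c : 'rV['F_2]_n) (A : set (n.-tuple Y)) : measurable A ->
  block_law ch (x + c) (flip_word c @^-1` A) = block_law ch x A.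
Proof.
move=> mA.
have mA' : measurable (flip_word c @^-1` A).
  by rewrite -[_ @^-1` _]setTI; exact: measurable_flip_word.
have E z B : measurable B -> (\int[block_law ch z]_y (\1_B y)%:E = block_law ch z B)%E.
  by move=> mB; rewrite integral_indic// setIT.
rewrite -!E// [RHS](@integral_product_law_map _ _ _ n
  (fun j => law ch (modulate ((x + c) 0 j))) _ (fun j => flip_bit ch (c 0 j)))//.
- by move=> j; exact: measurable_flip_bit.
- by move=> j f mf f0; rewrite mxE integral_law_flip.
- exact/measurable_EFinP/measurable_indic.
Qed.

End block.

(** * Generator matrix, syndromes and cosets of the code *)

Section code_bijection.
Context {n r : nat} {C : {vspace 'rV['F_2]_n}} {H : 'M['F_2]_(r, n)}
  {enc : 'Hom('rV['F_2]_(\dim C), 'rV['F_2]_n)}.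
Hypotheses (fH : full_rank_parity_check C H) (encC : is_encoder enc).

Let G : 'M['F_2]_(\dim C, n) := lin1_mx enc.

Lemma encE u : enc u = u *m G. Proof. by rewrite mul_rV_lin1. Qed.

Lemma enc_inj : injective enc.
Proof.
have [/eqP + _] := encC => /lker0P inj u v; exact: inj.
Qed.

Lemma enc_mem u : enc u \in C.
Proof.
have [_ img] := encC; have : enc u \in limg enc by rewrite memv_img ?memvf.
by rewrite img.
Qed.

Lemma row_free_enc : row_free G.
Proof.
rewrite -kermx_eq0; apply/eqP/row_matrixP => i; rewrite row0.
apply: enc_inj; rewrite linear0 encE.
by apply/sub_kermxP; exact: row_sub.
Qed.

Lemma in_dual_kermx (u : 'rV['F_2]_n) : in_dual C u <-> (u <= kermx G^T)%MS.
Proof.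
have [_ img] := encC; split=> [du|/sub_kermxP uG v].
  apply/sub_kermxP/rowP => i; rewrite [RHS]mxE.
  have := du _ (enc_mem (delta_mx 0 i)).
  rewrite encE -rowE => /matrixP/(_ 0 0).
  rewrite [X in _ = X -> _]mxE => <-; rewrite !mxE.
  by apply: eq_bigr => j _; rewrite !mxE.
rewrite -img => /memv_imgP[w _ ->].
by rewrite encE trmx_mul mulmxA uG mul0mx.
Qed.

(** The rows of [H] form a basis of the dual code, which is the kernel of [G^T], of dimension
    [n - \dim C]. *)
Lemma dim_code : (r + \dim C)%N = n.
Proof.
have [fr dual] := fH.
have -> : r = \rank (kermx G^T).
  rewrite -(eqP fr); apply/eqmx_rank/andP; split; apply/rV_subP => u.
    by move=> /dual/in_dual_kermx.
  by move=> /in_dual_kermx/dual.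
rewrite mxrank_ker mxrank_tr (eqP row_free_enc) subnK//.
by rewrite -[X in (X <= _)%N](eqP row_free_enc) rank_leq_col.
Qed.

Lemma enc_syndrome u : enc u *m H^T = 0.
Proof.
have [_ dual] := fH.
apply: trmx_inj; rewrite trmx_mul trmxK trmx0.
apply/row_matrixP => i; rewrite row_mul row0.
have /dual : (row i H <= H)%MS by exact: row_sub.
by apply; exact: enc_mem.
Qed.

(** Independent rows give a right inverse, hence a linear choice [s *m S] of a word with syndrome
    [s]. *)
Lemma syndrome_section : exists S : 'M['F_2]_(r, n), S *m H^T = 1%:M.
Proof.
have [/row_freeP[B HB] _] := fH.
by exists B^T; rewrite -trmx_mul HB trmx1.
Qed.

(** The syndrome recovers [s], after which [u] is determined by injectivity of the encoder;
    [dim_code] equates the cardinalities. *)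
Lemma coset_bij (S : 'M['F_2]_(r, n)) : S *m H^T = 1%:M ->
  bijective (fun su : 'rV['F_2]_r * 'rV['F_2]_(\dim C) => enc su.2 + su.1 *m S).
Proof.
move=> SH; apply: inj_card_bij => [[s u] [s' u']/= e|].
  have es : s = s'.
    have := congr1 (mulmx^~ H^T) e.
    by rewrite !mulmxDl !enc_syndrome !add0r -!mulmxA SH !mulmx1.
  by move: e; rewrite es => /addIr/enc_inj ->.
by rewrite card_prod !card_mx !mul1n -expnD dim_code.
Qed.

End code_bijection.

(** * The bound at finite block length *)

Section block_bound.
Context d (Y : measurableType d) (R : realType) (ch : mbios Y R) (n r : nat)
  (C : {vspace 'rV['F_2]_n}) (H : 'M['F_2]_(r, n))
  (enc : 'Hom('rV['F_2]_(\dim C), 'rV['F_2]_n))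
  (dec : n.-tuple Y -> 'rV['F_2]_(\dim C)).
Hypotheses (fH : full_rank_parity_check C H) (encC : is_encoder enc)
  (mdec : measurable_decoder dec).

(** The mean over the output of the pointwise entropy bound. The powers of [tau] stand on the left,
    so that only nonnegative functions are averaged. *)
Lemma block_bound N (delta : R) : 0 < delta < 1 ->
  n%:R * (ln 2 * (1 - capacity ch))
    + \sum_(i < r) \sum_(1 <= p < N) hcoef p / 2 * g ch p ^+ check_degree H i
  <= r%:R * ln 2 + (\dim C)%:R * - ln (1 - delta)
    + - ln delta * ((\dim C)%:R * bit_error_prob ch enc dec).
Proof.
move=> d01; have /andP[d0 d1] := d01.
have ld : 0 <= - ln delta by rewrite oppr_ge0 ln_le0// ltW.
have ld' : 0 <= - ln (1 - delta) by rewrite oppr_ge0 ln_le0// gerBl ltW.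
have natE m (x : R) : m%:R * x = \sum_(i < m) x.
  by rewrite sumr_const card_ord mulr_natl.
have [S SH] := syndrome_section fH.
pose c (su : 'rV['F_2]_r * 'rV['F_2]_(\dim C)) := enc su.2 + su.1 *m S.
have cH su : c su *m H^T = su.1.
  by rewrite mulmxDl (enc_syndrome fH)// add0r -mulmxA SH mulmx1.
have bij_c : bijective c by exact: (coset_bij fH encC SH).
pose wrong (l : 'I_(\dim C)) (u : 'rV['F_2]_(\dim C)) := [set y | dec y 0 l != u 0 l].
have mwrong l u : measurable (wrong l u).
  rewrite (_ : wrong l u = ~` [set y | dec y 0 l = u 0 l]); last first.
    by apply/seteqP; split => y /eqP.
  by apply: measurableC; exact: mdec.
have mwrong' l u (s : 'rV_n) : measurable (flip_word ch s @^-1` wrong l u).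
  by rewrite -[_ @^-1` _]setTI; exact: measurable_flip_word.
pose lower (y : n.-tuple Y) := \sum_j hbin (softs ch y j)
  + \sum_(i < r) \sum_(1 <= p < N) hcoef p / 2 * tau (softs ch y) (check_support H i) ^+ (2 * p).
(* The coset of syndrome [s] is decoded after flipping by its representative
   [s *m S]. *)
pose upper (y : n.-tuple Y) := r%:R * ln 2 + (\dim C)%:R * - ln (1 - delta)
  + - ln delta * \sum_l \sum_su
      qprod (softs ch y) (c su) * \1_(flip_word ch (su.1 *m S) @^-1` wrong l su.2) y.
have lu y : lower y <= upper y.
  have := @equivocation_bound _ _ _ _ (softs ch y) (softs_le1 ch y) H c bij_c cH
    (fun s => dec (flip_word ch (s *m S) y)) delta d01.
  rewrite /lower /upper.
  have -> : \sum_l \sum_su qprod (softs ch y) (c su) *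
      (dec (flip_word ch (su.1 *m S) y) 0 l != su.2 0 l)%:R =
      \sum_l \sum_su qprod (softs ch y) (c su) *
      \1_(flip_word ch (su.1 *m S) @^-1` wrong l su.2) y :> R.
    apply: eq_bigr => l _; apply: eq_bigr => su _; congr (_ * _).
    by rewrite indicE; congr (nat_of_bool _)%:R; apply/idP/idP; rewrite inE.
  have : \sum_i hbin (tau (softs ch y) (check_support H i)) +
      \sum_(i < r) \sum_(1 <= p < N) hcoef p / 2 * tau (softs ch y) (check_support H i) ^+ (2 * p)
      <= r%:R * ln 2.
    rewrite -big_split/= natE; apply: ler_sum => i _.
    have := hbin_le_hpoly N (tau_le1 (softs_le1 ch y) (check_support H i)).
    rewrite hpolyE mulr_suml; move: (hbin _) => h hle.
    rewrite -lerBrDr; apply: (le_trans hle).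
    by rewrite lerD2l lerN2; apply: ler_sum => p _; rewrite mulrAC.
  by move=> B1 E1; lra.
apply: (@le_mean _ _ _ (avg_block_law ch n) lower _ upper) lu.
- apply: has_meanD.
    rewrite natE; apply: has_mean_sum => j _; exact: has_mean_hbin.
  apply: has_mean_sum => i _; apply: has_mean_sum => p.
  rewrite mem_index_iota => /andP[p0 _]; apply: has_meanZ.
    by rewrite divr_ge0// hcoef_ge0.
  exact: has_mean_tau.
- apply: has_meanD.
    apply: has_mean_cst; rewrite addr_ge0// mulr_ge0//.
    by rewrite ln_ge0// ler1n.
  apply: has_meanZ => //.
  have -> : (\dim C)%:R * bit_error_prob ch enc dec =
      \sum_l \sum_(su : 'rV['F_2]_r * 'rV['F_2]_(\dim C))
        2 ^- n * fine (block_law ch (enc su.2) (wrong l su.2)).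
    rewrite /bit_error_prob mulrA.
    (* In dimension 0 the factor times its inverse is 0 rather than 1, but both sides are then empty
       sums. *)
    have [k0|kn] := eqVneq (\dim C) 0%N.
      rewrite big1 ?mulr0; last by move=> l; have := ltn_ord l; rewrite {2}k0.
      by rewrite big1// => l; have := ltn_ord l; rewrite {2}k0.
    rewrite divff ?pnatr_eq0// mul1r; apply: eq_bigr => l _.
    rewrite -(pair_bigA _ (fun (s : 'rV['F_2]_r) u =>
      2 ^- n * fine (block_law ch (enc u) (wrong l u))))/=.
    (* The summand does not depend on the syndrome: [2 ^ r] equal terms turn the weight [2 ^- n]
       into [2 ^- \dim C]. *)
    rewrite sumr_const card_mx card_Fp// mul1n -mulr_sumr -mulrnAl; congr (_ * _).
    have e : 2 ^+ n = 2 ^+ r * 2 ^+ \dim C :> R by rewrite -exprD (dim_code fH encC).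
    rewrite e invfM -[RHS]mulr_natl natrX mulrA divff ?mul1r//.
  apply: has_mean_sum => l _; apply: has_mean_sum => su _.
  (* By symmetry, the flipped decoder errs on a coset word exactly as often as the decoder does on
     the codeword. *)
  rewrite -(block_law_flip ch (enc su.2) (su.1 *m S) (mwrong l su.2)).
  exact: has_mean_qprod.
Qed.

End block_bound.

(** * Asymptotics *)

Section degree_distribution.
Context {R : realType} {r n : nat} (H : 'M['F_2]_(r, n)).

Lemma check_fraction_ge0 k : 0 <= check_fraction R H k.
Proof. by rewrite divr_ge0. Qed.

(** Grouping the checks by degree; those of degree at least [K] are dropped, which costs nothing but
    equality since [G >= 0]. *)
Lemma check_fraction_sum_le (G : nat -> R) K : (forall k, 0 <= G k) ->
  r%:R * \sum_(k < K) check_fraction R H k * G k <= \sum_(i < r) G (check_degree H i).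
Proof.
move=> G0; rewrite mulr_sumr.
have E (k : 'I_K) : r%:R * (check_fraction R H k * G k) =
    \sum_(i < r) if check_degree H i == k then G k else 0.
  rewrite -big_mkcond sumr_const /check_fraction mulrA -[RHS]mulr_natl; congr (_ * _).
  rewrite (_ : #|_|%SET = #|[pred i | check_degree H i == k]|); last first.
    by apply: eq_card => i; rewrite !inE.
  have [r0|rn] := eqVneq r 0%N.
    by rewrite eq_card0 ?mul0r ?mulr0// => i; have := ltn_ord i; rewrite {2}r0.
  by rewrite mulrCA divff ?mulr1// pnatr_eq0.
under eq_bigr do rewrite E.
rewrite exchange_big; apply: ler_sum => i _ /=; rewrite -big_mkcond.
have [dK|Kd] := ltnP (check_degree H i) K.
  by rewrite (big_pred1 (Ordinal dK))// => k; rewrite eq_sym.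
by rewrite big_pred0// => k; apply/gtn_eqF/(leq_trans (ltn_ord k)).
Qed.

Lemma check_fraction_sum_le1 K : \sum_(k < K) check_fraction R H k <= 1.
Proof.
have [r0|rn] := eqVneq r 0%N.
  have e : r%:R = 0 :> R by rewrite r0.
  by rewrite big1// => k _; rewrite /check_fraction e invr0 mulr0.
have := @check_fraction_sum_le (fun=> 1) K (fun=> ler01).
under eq_bigr do rewrite mulr1.
by rewrite sumr_const card_ord ger_pMr// ltr0n lt0n.
Qed.

End degree_distribution.

Section g_bounds.
Context d (Y : measurableType d) (R : realType) (ch : mbios Y R).

Lemma has_mean_soft_pow p : (0 < p)%N ->
  has_mean (avg_law ch) (fun y => soft ch y ^+ (2 * p)) (g ch p).
Proof.
move=> p0; split; last exact: integral_soft_pow.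
  by apply: measurable_funX; exact: measurable_soft.
by move=> y; rewrite exprM exprn_ge0// sqr_ge0.
Qed.

Lemma g_itv p : (0 < p)%N -> 0 <= g ch p <= 1.
Proof.
move=> /has_mean_soft_pow gp; apply/andP; split.
  by apply: (le_mean (has_mean_cst _ (lexx 0)) gp) => y; have [] := gp.
apply: (le_mean gp (has_mean_cst _ ler01)) => y.
by rewrite exprM -real_normK ?num_real// -exprM exprn_ile1// soft_le1.
Qed.

End g_bounds.

Lemma nonneg_bounded_series_cvg {R : realType} (u : nat -> R) (b : R) :
  (forall k, 0 <= u k) -> (forall K, \sum_(0 <= k < K) u k <= b) ->
  cvgn [series u k]_k /\ limn [series u k]_k <= b.
Proof.
move=> u0 ub.
have c : cvgn [series u k]_k.
  apply: nondecreasing_is_cvgn.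
    by apply/nondecreasing_seqP => K; rewrite /series/= big_nat_recr//= lerDl.
  by exists b => _ [K _ <-]; exact: ub.
by split=> //; apply: limr_le => //; near=> K; exact: ub.
Unshelve. all: by end_near. Qed.

Lemma cvg_seq_sum {R : realType} (I : Type) (s : seq I) (f : I -> nat -> R) (a : I -> R) :
  (forall i, f i @ \oo --> a i) ->
  (fun m => \sum_(i <- s) f i m) @ \oo --> \sum_(i <- s) a i.
Proof.
move=> fa; elim: s => [|i s IH].
  rewrite big_nil (_ : (fun _ => _) = (fun=> 0)); first exact: cvg_cst.
  by apply/funext => m; rewrite big_nil.
rewrite big_cons (_ : (fun _ => _) = f i \+ (fun m => \sum_(j <- s) f j m)).
  exact: cvgD.
by apply/funext => m; rewrite big_cons.
Qed.

(** * The limit in the block length *)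

Section asymptotic.
Context {R : realType} {d : measure_display} {Y : measurableType d} (ch : mbios Y R)
  {n : nat -> nat} {C : forall m, {vspace 'rV['F_2]_(n m)}}
  {r : nat -> nat} {H : forall m, 'M['F_2]_(r m, n m)}
  {enc : forall m, 'Hom('rV['F_2]_(\dim (C m)), 'rV['F_2]_(n m))}
  {dec : forall m, (n m).-tuple Y -> 'rV['F_2]_(\dim (C m))}
  {Gamma : nat -> R} {Rinf : R}.
Hypotheses (n_cvg : n @ \oo --> \oo)
  (fH : forall m, full_rank_parity_check (C m) (H m))
  (Gamma_cvg : forall k, (fun m => check_fraction R (H m) k) @ \oo --> Gamma k)
  (rate_cvg : (fun m => rate (C m) R) @ \oo --> Rinf)
  (encC : forall m, is_encoder (enc m))
  (mdec : forall m, measurable_decoder (@dec m))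
  (err_cvg : (fun m => bit_error_prob ch (enc m) (@dec m)) @ \oo --> (0 : R)).

Lemma Gamma_ge0 k : 0 <= Gamma k.
Proof.
by apply: (cvgr_to_ge (@Gamma_cvg k)); near=> m; exact: check_fraction_ge0.
Unshelve. all: by end_near. Qed.

(** Only an inequality survives in the limit, since mass may escape to ever larger degrees. *)
Lemma Gamma_sum_le1 K : \sum_(0 <= k < K) Gamma k <= 1.
Proof.
have h := @cvg_seq_sum R _ (index_iota 0 K)
  (fun k m => check_fraction R (H m) k) Gamma (fun k => @Gamma_cvg k).
apply: (cvgr_to_le h).
by near=> m; rewrite big_mkord check_fraction_sum_le1.
Unshelve. all: by end_near. Qed.

Lemma rate_itv m : 0 <= rate (C m) R <= 1.
Proof.
rewrite divr_ge0//=; have [n0|n0] := eqVneq (n m) 0%N.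
  have e : (n m)%:R = 0 :> R by rewrite n0.
  by rewrite /rate e invr0 mulr0.
rewrite ler_pdivrMr ?ltr0n ?lt0n// mul1r ler_nat.
by rewrite -[X in (_ <= X)%N](dim_code (@fH m) (@encC m)) leq_addl.
Qed.

Lemma Rinf_itv : 0 <= Rinf <= 1.
Proof.
apply/andP; split.
  by apply: (cvgr_to_ge rate_cvg); near=> m; case/andP: (rate_itv m).
by apply: (cvgr_to_le rate_cvg); near=> m; case/andP: (rate_itv m).
Unshelve. all: by end_near. Qed.

(** What a check of degree [k] takes off [ln 2], with the series in [p] truncated. *)
Let w N k := \sum_(1 <= p < N) hcoef p / 2 * g ch p ^+ k.

Lemma w_ge0 N k : 0 <= w N k.
Proof.
rewrite /w big_nat sumr_ge0// => p /andP[p0 _].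
by rewrite mulr_ge0 ?divr_ge0 ?hcoef_ge0// exprn_ge0//; case/andP: (g_itv ch p0).
Qed.

(** [block_bound] divided by the block length, with [\dim C = n * rate] and [r = n * (1 - rate)]. *)
Lemma rate_bound N K delta m : 0 < delta < 1 -> (0 < n m)%N ->
  ln 2 * (1 - capacity ch)
    + (1 - rate (C m) R) * \sum_(0 <= k < K) check_fraction R (H m) k * w N k
  <= (1 - rate (C m) R) * ln 2 + rate (C m) R * - ln (1 - delta)
    + - ln delta * (rate (C m) R * bit_error_prob ch (enc m) (@dec m)).
Proof.
move=> d01 n0.
have nn : (n m)%:R != 0 :> R by rewrite pnatr_eq0 -lt0n.
have rE : (r m)%:R = (n m)%:R * (1 - rate (C m) R).
  rewrite /rate mulrBr mulr1 mulrCA divff// mulr1.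
  by rewrite -[X in X%:R - _](dim_code (@fH m) (@encC m)) natrD addrK.
have kE : (\dim (C m))%:R = (n m)%:R * rate (C m) R.
  by rewrite /rate mulrCA divff// mulr1.
have h2 := @check_fraction_sum_le R _ _ (H m) (w N) K (w_ge0 N).
have h1 := block_bound ch (@fH m) (@encC m) (@mdec m) N d01.
rewrite -[X in _ + X <= _]/(\sum_(i < r m) w N (check_degree (H m) i)) in h1.
rewrite big_mkord -(@ler_pM2l _ (n m)%:R) ?ltr0n//.
rewrite rE kE in h1; rewrite rE in h2.
by move: h1 h2; move: (\sum_(_ < r m) _) (\sum_(_ < K) _) => s1 s2 h1 h2; lra.
Qed.

Lemma limit_bound N K :
  ln 2 * (1 - capacity ch) + (1 - Rinf) * \sum_(0 <= k < K) Gamma k * w N k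
  <= (1 - Rinf) * ln 2.
Proof.
have /andP[R0 R1] := Rinf_itv.
apply/ler_addgt0Pr => e e0.
(* Chosen so that [- ln (1 - delta) = e]. For this fixed [delta] the error term vanishes with the
   bit error probability, and the slack left is [Rinf * e <= e]. *)
pose delta := 1 - expR (- e).
have d01 : 0 < delta < 1.
  by rewrite subr_gt0 -[ltRHS]expR0 ltr_expR oppr_lt0 e0 gtrBl expR_gt0.
have de : - ln (1 - delta) = e by rewrite subKr expRK opprK.
have cR : (fun m => 1 - rate (C m) R) @ \oo --> 1 - Rinf.
  by apply: cvgB => //; exact: cvg_cst.
have cS : (fun m => \sum_(0 <= k < K) check_fraction R (H m) k * w N k) @ \oo -->
    \sum_(0 <= k < K) Gamma k * w N k.
  apply: (@cvg_seq_sum R _ _ (fun k m => check_fraction R (H m) k * w N k)) => k.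
  by apply: cvgM; [exact: Gamma_cvg|exact: cvg_cst].
have lo : (fun m => ln 2 * (1 - capacity ch) + (1 - rate (C m) R) *
    \sum_(0 <= k < K) check_fraction R (H m) k * w N k) @ \oo -->
    ln 2 * (1 - capacity ch) + (1 - Rinf) * \sum_(0 <= k < K) Gamma k * w N k.
  by apply: cvgD; [exact: cvg_cst|exact: cvgM].
have hi : (fun m => (1 - rate (C m) R) * ln 2 + rate (C m) R * - ln (1 - delta)
    + - ln delta * (rate (C m) R * bit_error_prob ch (enc m) (@dec m))) @ \oo -->
    (1 - Rinf) * ln 2 + Rinf * - ln (1 - delta) + - ln delta * (Rinf * 0).
  apply: cvgD; last by apply: cvgM; [exact: cvg_cst|exact: cvgM].
  by apply: cvgD; apply: cvgM => //; exact: cvg_cst.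
have n_gt0 : \forall m \near \oo, (0 < n m)%N := n_cvg (nbhs_infty_gt 0).
apply: (@le_trans _ _ ((1 - Rinf) * ln 2 + Rinf * e)); last first.
  by rewrite lerD2l ger_pMl.
rewrite de mulr0 mulr0 addr0 in hi.
apply: (ler_cvg_to lo hi); near=> m; rewrite -[X in rate _ _ * X]de.
by apply: rate_bound => //; near: m.
Unshelve. all: by end_near. Qed.

End asymptotic.

(** * Removal of both truncations, and the conclusion *)

Theorem corollary2p1 (R : realType) (d : measure_display)
    (Y : measurableType d) (ch : mbios Y R)
    (n : nat -> nat) (C : forall m, {vspace 'rV['F_2]_(n m)})
    (r : nat -> nat) (H : forall m, 'M['F_2]_(r m, n m))
    (enc : forall m, 'Hom('rV['F_2]_(\dim (C m)), 'rV['F_2]_(n m)))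
    (dec : forall m, (n m).-tuple Y -> 'rV['F_2]_(\dim (C m)))
    (Gamma : nat -> R) (Rinf : R) :
  n @ \oo --> \oo ->
  (forall m, full_rank_parity_check (C m) (H m)) ->
  (forall k, (fun m => check_fraction R (H m) k) @ \oo --> Gamma k) ->
  (fun m => rate (C m) R) @ \oo --> Rinf ->
  (forall m, is_encoder (enc m)) ->
  (forall m, measurable_decoder (dec m)) ->
  (fun m => bit_error_prob ch (enc m) (dec m)) @ \oo --> (0 : R) ->
  Rinf <= 1 - (1 - capacity ch) /
    (1 - (2 * ln 2)^-1 *
      limn (fun N => \sum_(1 <= p < N)
        gen_fun Gamma (g ch p) / (p%:R * (2 * p%:R - 1)))).
Proof.
move=> n_cvg fH Gamma_cvg rate_cvg encC mdec err_cvg.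
have lb := limit_bound n_cvg fH Gamma_cvg rate_cvg encC mdec err_cvg.
have G0 := Gamma_ge0 Gamma_cvg; have G1 := Gamma_sum_le1 Gamma_cvg.
have /andP[R0 R1] := Rinf_itv fH rate_cvg encC.
have gen_cvg p : (0 < p)%N ->
    [series Gamma k * g ch p ^+ k]_k @ \oo --> gen_fun Gamma (g ch p) /\
    0 <= gen_fun Gamma (g ch p) <= 1.
  move=> /(g_itv ch)/andP[gp0 gp1].
  have u0 k : 0 <= Gamma k * g ch p ^+ k by rewrite mulr_ge0 ?exprn_ge0.
  have [c le1] := @nonneg_bounded_series_cvg _ (fun k => Gamma k * g ch p ^+ k) 1 u0 ltac:(
    move=> K; apply: le_trans (G1 K); apply: ler_sum => k _; rewrite ler_piMr// exprn_ile1//).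
  split=> //; rewrite le1 andbT.
  by rewrite /gen_fun; apply: limr_ge => //; near=> K; rewrite /series/= sumr_ge0.
pose T N := \sum_(1 <= p < N) gen_fun Gamma (g ch p) / (p%:R * (2 * p%:R - 1)).
have T_nd : nondecreasing_seq T.
  apply/nondecreasing_seqP => N; rewrite /T; case: N => [|N].
    by rewrite !big_geq.
  rewrite [leRHS]big_nat_recr//= lerDl mulr_ge0//.
  by have [_ /andP[]] := gen_cvg N.+1 isT.
(* Each [gen_fun Gamma (g ch p)] is at most 1, so [T N] is at most [(hpoly N).[1]]. *)
have T_le N : T N <= 2 * ln 2.
  apply: le_trans (hpoly1_le N); rewrite hpolyE /T big_nat [leRHS]big_nat.
  apply: ler_sum => p /andP[p0 _]; rewrite expr1n mulr1 ler_piMl ?hcoef_ge0//.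
  by have [_ /andP[]] := gen_cvg p p0.
have T_bound N : ln 2 * (1 - capacity ch) + (1 - Rinf) * (T N / 2) <= (1 - Rinf) * ln 2.
  have h : (fun K => ln 2 * (1 - capacity ch) + (1 - Rinf) *
      \sum_(p <- index_iota 1 N) hcoef p / 2 * [series Gamma k * g ch p ^+ k]_k K) @ \oo -->
      ln 2 * (1 - capacity ch) + (1 - Rinf) * (T N / 2).
    have -> : T N / 2 = \sum_(p <- index_iota 1 N) hcoef p / 2 * gen_fun Gamma (g ch p).
      by rewrite mulr_suml; apply: eq_bigr => p _; rewrite -mulrA mulrC.
    apply: cvgD; first exact: cvg_cst.
    apply: cvgM; first exact: cvg_cst.
    apply: (@cvg_seq_sum R _ _ (fun p K => hcoef p / 2 * [series Gamma k * g ch p ^+ k]_k K)).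
    (* Convergence is asked at every index; at 0, outside the range of summation, [hcoef]
       vanishes. *)
    case=> [|p].
      rewrite (_ : (fun _ => _) = (fun=> 0)); last first.
        by apply/funext => K; rewrite /hcoef mul0r invr0 !mul0r.
      by rewrite /hcoef mul0r invr0 !mul0r; exact: cvg_cst.
    by apply: cvgM; [exact: cvg_cst|have [] := gen_cvg p.+1 isT].
  (* For fixed [N], the finite sums over [k] and [p] are exchanged, and [K] tends to infinity. *)
  apply: (cvgr_to_le h); near=> K.
  apply: le_trans (lb N K); rewrite lerD2l ler_wpM2l ?subr_ge0//.
  under [leRHS]eq_bigr do rewrite mulr_sumr.
  rewrite exchange_big/=; apply: ler_sum => p _; rewrite mulr_sumr.
  by apply: ler_sum => k _; rewrite mulrCA.
have T_cvg : cvgn T.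
  by apply: nondecreasing_is_cvgn => //; exists (2 * ln 2) => _ [N _ <-]; exact: T_le.
rewrite -[X in limn X]/T; set Tl := limn T.
have Tl_le : Tl <= 2 * ln 2 by apply: limr_le => //; near=> N; exact: T_le.
have Tl_bound : ln 2 * (1 - capacity ch) + (1 - Rinf) * (Tl / 2) <= (1 - Rinf) * ln 2.
  have h : (fun N => ln 2 * (1 - capacity ch) + (1 - Rinf) * (T N / 2)) @ \oo -->
      ln 2 * (1 - capacity ch) + (1 - Rinf) * (Tl / 2).
    apply: cvgD; first exact: cvg_cst.
    by do 2 (apply: cvgM; first exact: cvg_cst || exact: T_cvg); exact: cvg_cst.
  by apply: (cvgr_to_le h); near=> N; exact: T_bound.
have l2 : 0 < ln 2 :> R by exact: ln2_gt0.
set D := 1 - (2 * ln 2)^-1 * Tl.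
have DE : ln 2 * D = ln 2 - Tl / 2.
  by rewrite /D; move: (ln 2) l2 => l l0; field; rewrite gt_eqF.
have D0 : 0 <= D by rewrite -(pmulr_rge0 _ l2) DE; lra.
(* For [D = 0] the quotient is 0 by convention, and the claim reduces to [Rinf <= 1]. *)
have [->|Dn] := eqVneq D 0; first by rewrite invr0 mulr0 subr0.
rewrite lerBrDl -lerBrDr ler_pdivrMr ?lt0r ?Dn// -(ler_pM2l l2) mulrCA DE.
by lra.
Unshelve. all: by end_near. Qed.
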